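(* Let Assumptions A1–A5 (stated in the context) hold and let $\{x_k\}$ be a sequence generated by Algorithm IR-NS. If there is a constant $\overline{\alpha}>0$ such that $\alpha_k\ge\overline{\alpha}$ for all $k\in\mathbb{N}$, then, almost surely, there exists an accumulation point $x^*$ of $\{x_k\}$ which is a solution of the problem $\min_{x\in\mathbb{R}^n} f(x)$, i.e. $f(x^* )=\inf_{y\in\mathbb{R}^n} f(y)$.
   Context: Problem: $\min_{x\in\mathbb{R}^n} f(x)=E[F(x,\xi)]$, where $F:\mathbb{R}^n\times\mathbb{R}^m\to\mathbb{R}$ is continuous and convex in $x$ and bounded from below, $\xi:\Omega\to\mathbb{R}^m$ is a random vector on a probability space $(\Omega,\mathcal{F},P)$. For an i.i.d. sample $\xi_1,\dots,\xi_N$ of $\xi$, the sample average approximation (SAA) is $f_N(x)=\frac1N\sum_{i=1}^N f_i(x)$, $f_i(x)=F(x,\xi_i)$. $\partial f_N(x)$ is the convex subdifferential. The function $h:\mathbb{N}\to[0,\infty)$ is a fixed monotonically decreasing function with $\lim_{N\to\infty}h(N)=0$. The merit function is $\Phi(x,N,\theta)=\theta f_N(x)+(1-\theta)h(N)$, $\theta\in(0,1)$. Algorithm IR-NS. S0: Given $x_0\in\mathbb{R}^n$, $N_0\in\mathbb{N}$, $\theta_0,r\in(0,1)$, $\beta,\gamma,\overline{\gamma}>0$. Set $k=0$. S1: Find $\tilde N_{k+1}\ge N_k$ such that $h(\tilde N_{k+1})\le r\,h(N_k)$ and (R) $f_{\tilde N_{k+1}}(x_k)-f_{N_k}(x_k)\le\beta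 h(N_k)$. S2: If $\Phi(x_k,\tilde N_{k+1},\theta_k)-\Phi(x_k,N_k,\theta_k)\le\frac{1-r}{2}\big(h(\tilde N_{k+1})-h(N_k)\big)$ set $\theta_{k+1}=\theta_k$; else $\theta_{k+1}=\frac{(1+r)(h(N_k)-h(\tilde N_{k+1}))}{2[f_{\tilde N_{k+1}}(x_k)-f_{N_k}(x_k)+h(N_k)-h(\tilde N_{k+1})]}$. S3: Choose $N_{k+1}\le\tilde N_{k+1}$, a direction $p_{N_{k+1}}(x_k)\in\mathbb{R}^n$ (of the type in Assumption A2) and $\alpha_k\in(0,1]$ such that (i) $f_{N_{k+1}}(x_k+\alpha_kp_{N_{k+1}}(x_k))-f_{\tilde N_{k+1}}(x_k)\le-\gamma\alpha_k\|p_{N_{k+1}}(x_k)\|^2$, (ii) $h(N_{k+1})\le h(\tilde N_{k+1})+\overline{\gamma}\alpha_k^2\|p_{N_{k+1}}(x_k)\|^2$, (iii) $\Phi(x_k+\alpha_kp_{N_{k+1}}(x_k),N_{k+1},\theta_{k+1})-\Phi(x_k,N_k,\theta_{k+1})\le\frac{1-r}{2}\big(h(\tilde N_{k+1})-h(N_k)\big)$. S4: Set $p_k=p_{N_{k+1}}(x_k)$, $x_{k+1}=x_k+\alpha_kp_k$, $k:=k+1$, go to S1. Sampling: the SAA functions use i.i.d. samples. In S1 a random sample is generated for $f_{\tilde N_{k+1}}$; in S3 the sample for $f_{N_{k+1}}$ may differ from it. With $\mathcal{F}_k$ the $\sigma$-algebra generated by $x_0,\dots,x_k$, one has $E[f_{\tilde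 N_{k+1}}(x_k)\mid\mathcal{F}_k]=f(x_k)$ and $E[f_{N_{k+1}}(x_k)\mid\mathcal{F}_k]=f(x_k)$. Assumptions. A1: the functions $f_i(x)=F(x,\xi_i)$, $i=1,2,\dots$, are continuous, convex and bounded from below by a constant $C$ for all $\xi_i$. A2: for any given $N$, $x$ and $B$ such that $mI\preceq B(x)\preceq MI$, for some positive bounded constants $m\le M$, one can compute a direction $p_N(x)\in\mathbb{R}^n$ such that $p_N(x)=-B(x)\bar g_N(x)$ and $\sup_{g\in\partial f_N(x)}g^Tp_N(x)\le-\frac m2\|\bar g_N(x)\|^2$, where $\bar g_N(x)\in\partial f_N(x)$. A3: there exists $\beta$ such that (R) holds for each $k$. A4: $f$ has bounded level sets. A5: $F$ is dominated by an integrable function on a bounded open set $\tilde D^0$ with $D\subset\tilde D^0$. Here $D=\{x\in\mathbb{R}^n: f(x)\le C_2\}$, $C_2=C_0+2\beta C_1$, where $C_0$ is a constant with $F(x_0,\xi)\le C_0$ for any $\xi$ (assumed to exist) and $C_1>0$ is a constant with $\sum_{k=0}^\infty h(N_k)\le C_1<\infty$ (such a constant exists for Algorithm IR-NS by a known result). *)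

(* Defs.v *)
From HB Require Import structures.
From mathcomp Require Import all_boot all_order all_algebra.
From mathcomp Require Import all_classical all_reals all_analysis.
From mathcomp Require Import measurable_realfun.

Set Implicit Arguments.
Unset Strict Implicit.
Unset Printing Implicit Defensive.

Import Order.TTheory GRing.Theory Num.Theory.
Import numFieldNormedType.Exports.

Local Open Scope classical_set_scope.
Local Open Scope ring_scope.

(* Vectors are row vectors. The norm carried by 'rV[R]_n in the library is the
   max norm: it is used only through the topology and boundedness it induces.
   Euclidean quantities are expressed with [dotv]. *)

Definition dotv (R : realType) (n : nat) (u v : 'rV[R]_n) : R :=
  (u *m v^T) 0 0.

Definition sqnorm (R : realType) (n : nat) (u : 'rV[R]_n) : R := dotv u u.

Definition loewner_le (R : realType) (n : nat) (A B : 'M[R]_n) : Prop :=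
  (B - A)^T = B - A /\ forall v : 'rV[R]_n, 0 <= dotv (v *m (B - A)) v.

Definition subdifferential (R : realType) (n : nat) (phi : 'rV[R]_n -> R)
    (x : 'rV[R]_n) : set 'rV[R]_n :=
  [set g | forall y, phi x + dotv g (y - x) <= phi y].

(* R^n with its Borel sigma-algebra. *)
Notation borelRn R n := (g_sigma_algebraType (@open 'rV[R]_n)).

Definition random_vector (R : realType) (d : measure_display)
    (Omega : measurableType d) (n : nat) (X : Omega -> 'rV[R]_n) : Prop :=
  measurable_fun [set: Omega] (X : Omega -> borelRn R n).

Definition identically_distributed (R : realType) (d : measure_display)
    (Omega : measurableType d) (P : probability Omega R) (n : nat)
    (X Y : Omega -> 'rV[R]_n) : Prop :=
  forall A : set (borelRn R n), measurable A ->
    P (X @^-1` A) = P (Y @^-1` A).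

Definition mutually_independent (R : realType) (d : measure_display)
    (Omega : measurableType d) (P : probability Omega R) (n : nat)
    (Z : nat -> Omega -> 'rV[R]_n) : Prop :=
  forall (s : seq nat) (A : nat -> set (borelRn R n)), uniq s ->
    (forall i, measurable (A i)) ->
    P (\bigcap_(i in [set` s]) (Z i @^-1` A i)) =
    (\prod_(i <- s) P (Z i @^-1` A i))%E.

Definition iid_sample (R : realType) (d : measure_display)
    (Omega : measurableType d) (P : probability Omega R) (n : nat)
    (xi : Omega -> 'rV[R]_n) (Z : nat -> Omega -> 'rV[R]_n) : Prop :=
  [/\ forall i, random_vector (Z i),
      forall i, identically_distributed P (Z i) xi &
      mutually_independent P Z].

Definition history (R : realType) (d : measure_display)
    (Omega : measurableType d) (n : nat) (x : nat -> Omega -> 'rV[R]_n)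
    (k : nat) : set (set Omega) :=
  <<s \bigcup_(j in [set j | (j <= k)%N])
        preimage_set_system [set: Omega] (x j)
          (@measurable _ (borelRn R n)) >>.

(* Z is a version of the conditional expectation E[Y | G], where G is a
   sub-sigma-algebra of the measurable sets. *)
Definition is_cond_expectation (R : realType) (d : measure_display)
    (Omega : measurableType d) (P : probability Omega R)
    (G : set (set Omega)) (Y Z : Omega -> \bar R) : Prop :=
  [/\ P.-integrable [set: Omega] Y,
      P.-integrable [set: Omega] Z,
      forall B : set (\bar R), measurable B -> G (Z @^-1` B) &
      forall A, G A -> (\int[P]_(w in A) Z w = \int[P]_(w in A) Y w)%E].

(* f(x) = E[F(x, xi)]; since F is bounded from below this is well defined in
   ]-oo, +oo], and no integrability of F(x, xi) is presupposed. *)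
Definition objective (R : realType) (d : measure_display)
    (Omega : measurableType d) (P : probability Omega R) (n m : nat)
    (F : 'rV[R]_n -> 'rV[R]_m -> R) (xi : Omega -> 'rV[R]_m)
    (x : 'rV[R]_n) : \bar R :=
  'E_P[fun w => F x (xi w)]%E.

(* The sample average f_N built on the first N points of the sample u. *)
Definition saa (R : realType) (n m : nat) (F : 'rV[R]_n -> 'rV[R]_m -> R)
    (u : nat -> 'rV[R]_m) (N : nat) (x : 'rV[R]_n) : R :=
  N%:R^-1 * \sum_(i < N) F x (u i).

Definition merit (R : realType) (h : nat -> R) (phi : R) (N : nat)
    (theta : R) : R :=
  theta * phi + (1 - theta) * h N.

(* The direction is p = - B gbar (transposed, since vectors are rows). *)
Definition descent_direction (R : realType) (n : nat) (mB : R)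
    (phi : 'rV[R]_n -> R) (x : 'rV[R]_n) (B : 'M[R]_n) (p : 'rV[R]_n) : Prop :=
  exists gbar : 'rV[R]_n,
    [/\ subdifferential phi x gbar,
        p = - (gbar *m B^T) &
        (ereal_sup [set (dotv g p)%:E | g in subdifferential phi x] <=
          (- (mB / 2) * sqnorm gbar)%:E)%E].

Definition regular_integrand (R : realType) (n m : nat)
    (F : 'rV[R]_n -> 'rV[R]_m -> R) : Prop :=
  [/\ forall x, measurable_fun setT (F x : borelRn R m -> R),
      forall u, continuous (F ^~ u),
      forall u, @convex_function R 'rV[R]_n setT (F ^~ u) &
      exists C : R, forall x u, C <= F x u].

Definition assumption_A2 (R : realType) (n m : nat)
    (F : 'rV[R]_n -> 'rV[R]_m -> R) (mB MB : R) : Prop :=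
  forall (u : nat -> 'rV[R]_m) (N : nat) (x : 'rV[R]_n) (B : 'M[R]_n),
    (0 < N)%N -> loewner_le mB%:M B -> loewner_le B MB%:M ->
    exists p, descent_direction mB (saa F u N) x B p.

Definition assumption_A4 (R : realType) (n : nat)
    (f : 'rV[R]_n -> \bar R) : Prop :=
  forall c : R, bounded_set [set x | (f x <= c%:E)%E].

Definition assumption_A5 (R : realType) (d : measure_display)
    (Omega : measurableType d) (P : probability Omega R) (n m : nat)
    (F : 'rV[R]_n -> 'rV[R]_m -> R) (xi : Omega -> 'rV[R]_m)
    (D : set 'rV[R]_n) : Prop :=
  exists Dt : set 'rV[R]_n,
    [/\ open Dt, bounded_set Dt, D `<=` Dt &
     exists K : 'rV[R]_m -> R,
       [/\ measurable_fun setT (K : borelRn R m -> R),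
           P.-integrable [set: Omega] (fun w => (K (xi w))%:E) &
           forall x w, Dt x -> `|F x (xi w)| <= K (xi w)]].

(* One realization of Algorithm IR-NS. The sample points underlying f_{N_k} are
   z k 0, z k 1, ..., and those underlying f_{\tilde N_k} are zt k 0, zt k 1, ...
   The entries Nt 0 and zt 0 are not used. *)
Definition IR_NS (R : realType) (n m : nat) (F : 'rV[R]_n -> 'rV[R]_m -> R)
    (h : nat -> R) (mB MB r beta gamma gammabar : R)
    (x0 : 'rV[R]_n) (N0 : nat) (theta0 : R)
    (z zt : nat -> nat -> 'rV[R]_m) (N Nt : nat -> nat)
    (theta alpha : nat -> R) (p x : nat -> 'rV[R]_n) : Prop :=
  [/\ x 0%N = x0, N 0%N = N0, theta 0%N = theta0 &
   forall k : nat,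
   let fN := saa F (z k) (N k) in
   let fNt := saa F (zt k.+1) (Nt k.+1) in
   let fN1 := saa F (z k.+1) (N k.+1) in
   let hk := h (N k) in
   let ht := h (Nt k.+1) in
   [/\
    [/\ (N k <= Nt k.+1)%N,
        ht <= r * hk &
        fNt (x k) - fN (x k) <= beta * hk],
    theta k.+1 =
      (if merit h (fNt (x k)) (Nt k.+1) (theta k)
            - merit h (fN (x k)) (N k) (theta k) <= (1 - r) / 2 * (ht - hk)
       then theta k
       else (1 + r) * (hk - ht) /
            (2 * (fNt (x k) - fN (x k) + hk - ht))),
    (0 < N k.+1 <= Nt k.+1)%N,
    exists B : 'M[R]_n,
      [/\ loewner_le mB%:M B, loewner_le B MB%:M &
          descent_direction mB fN1 (x k) B (p k)] &
    [/\ 0 < alpha k <= 1,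
        fN1 (x k + alpha k *: p k) - fNt (x k)
          <= - gamma * alpha k * sqnorm (p k),
        h (N k.+1) <= ht + gammabar * alpha k ^+ 2 * sqnorm (p k),
        merit h (fN1 (x k + alpha k *: p k)) (N k.+1) (theta k.+1)
          - merit h (fN (x k)) (N k) (theta k.+1)
          <= (1 - r) / 2 * (ht - hk) &
        x k.+1 = x k + alpha k *: p k]]].

(* The random samples and sample sizes used along the iterations. Within each
   sample the points are i.i.d. copies of xi; nothing is required between
   different samples, which may coincide, overlap or be independent. *)
Definition saa_sampling (R : realType) (d : measure_display)
    (Omega : measurableType d) (P : probability Omega R) (n m : nat)
    (F : 'rV[R]_n -> 'rV[R]_m -> R) (xi : Omega -> 'rV[R]_m)
    (z zt : nat -> nat -> Omega -> 'rV[R]_m) (N Nt : nat -> Omega -> nat)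
    (x : nat -> Omega -> 'rV[R]_n) : Prop :=
  [/\ forall k, iid_sample P xi (z k) /\ iid_sample P xi (zt k.+1),
      forall k, measurable_fun [set: Omega] (N k) /\
                measurable_fun [set: Omega] (Nt k.+1),
      forall k, random_vector (x k) &
      forall k,
        is_cond_expectation P (history x k)
          (fun w => (saa F (fun i => zt k.+1 i w) (Nt k.+1 w) (x k w))%:E)
          (fun w => objective P F xi (x k w)) /\
        is_cond_expectation P (history x k)
          (fun w => (saa F (fun i => z k.+1 i w) (N k.+1 w) (x k w))%:E)
          (fun w => objective P F xi (x k w))].

(* Main.v *)
Require Import Defs.
From HB Require Import structures.
From mathcomp Require Import all_boot all_order all_algebra.
From mathcomp Require Import all_classical all_reals all_analysis.
From mathcomp Require Import measurable_realfun.
From mathcomp Require Import ring lra zify.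

(* Along a run the values f_{N_k}(x_k) decrease up to beta h(N_k), so the squared
   steps are summable; since the step sizes are bounded below, the subgradients
   of f_{N_{k+1}} at x_k tend to 0, whence f_{N_{k+1}}(x_k) <= f_{N_{k+1}}(y) + o(1)
   for every y. The sample sizes are random and may depend on the samples, so
   f_{N_{k+1}}(y) is compared with f(y) by a one-sided law of large numbers that
   is uniform over all sample sizes >= M and depends only on the law of xi; a
   strictly decreasing h with sum_k h(N_k) finite forces N_k -> oo. Taking
   expectations, E f(x_k) = E f_{N_{k+1}}(x_k) -> inf f, hence liminf f(x_k) =
   inf f almost surely, and compactness of the level sets together with the lower
   semicontinuity of f yields a minimizing accumulation point. *)

Set Implicit Arguments.
Unset Strict Implicit.
Unset Printing Implicit Defensive.

Import Order.TTheory GRing.Theory Num.Theory.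
Import numFieldNormedType.Exports.

Local Open Scope classical_set_scope.
Local Open Scope ring_scope.

(** * Deterministic descent along a run *)

Section deterministic.
Variable R : realType.

Section dot.
Variable n : nat.
Implicit Types u v w : 'rV[R]_n.

Lemma dotvE u v : dotv u v = \sum_i u 0 i * v 0 i.
Proof. by rewrite /dotv mxE; apply: eq_bigr => i _; rewrite mxE. Qed.

Lemma sqnormE u : sqnorm u = \sum_i u 0 i ^+ 2.
Proof. by rewrite /sqnorm dotvE. Qed.

Lemma sqnorm_ge0 u : 0 <= sqnorm u.
Proof. by rewrite sqnormE sumr_ge0// => i _; rewrite sqr_ge0. Qed.

Lemma sqnormZ (a : R) u : sqnorm (a *: u) = a ^+ 2 * sqnorm u.
Proof.
rewrite !sqnormE mulr_sumr; apply: eq_bigr => i _.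
by rewrite mxE exprMn.
Qed.

Lemma dotv_young (s : R) u v : 0 < s ->
  - dotv u v <= (s * sqnorm u + sqnorm v / s) / 2.
Proof.
move=> s0; rewrite dotvE !sqnormE mulr_sumr mulr_suml -big_split/=.
rewrite -sumrN mulr_suml; apply: ler_sum => i _.
rewrite -subr_ge0.
set a := u 0 i; set b := v 0 i.
have -> : (s * a ^+ 2 + b ^+ 2 / s) / 2 - - (a * b) =
          (s * a + b) ^+ 2 / (2 * s).
  by field; rewrite gt_eqF.
by rewrite divr_ge0 ?sqr_ge0// mulr_ge0// ltW.
Qed.

Lemma sqnorm_le_loewner (mB : R) (B : 'M[R]_n) (g : 'rV[R]_n) :
  0 < mB -> loewner_le mB%:M B ->
  mB ^+ 2 * sqnorm g <= sqnorm (- (g *m B^T)).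
Proof.
move=> m0 [symB posB]; set p := - _.
have BT : B^T = B.
  by move: symB; rewrite linearB/= tr_scalar_mx => /addIr.
have key : mB * sqnorm g <= - dotv p g.
  move: (posB g); rewrite BT in p *.
  rewrite /p /dotv mulmxBr mul_mx_scalar mulmxBl mulNmx -scalemxAl.
  rewrite [in X in X -> _]mxE [X in 0 <= _ + X -> _]mxE.
  rewrite [X in 0 <= _ - X -> _]mxE subr_ge0.
  by rewrite [X in _ <= - X]mxE opprK.
have yi : 0 < mB^-1 by rewrite invr_gt0.
have := dotv_young p g yi; rewrite invrK => yo.
have : mB * sqnorm g <= (mB^-1 * sqnorm p + sqnorm g * mB) / 2.
  exact: le_trans key yo.
set G := sqnorm g; set Q := sqnorm p => le1.
have : mB * (mB * G) <= mB * (mB^-1 * Q).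
  by rewrite ler_pM2l//; lra.
by rewrite mulrA -expr2 mulrA divff ?gt_eqF// mul1r.
Qed.

Lemma bounded_sqnorm (A : set 'rV[R]_n) (y : 'rV[R]_n) : bounded_set A ->
  exists V, forall v, A v -> sqnorm (y - v) <= V.
Proof.
move=> /pinfty_ex_gt0[M M0 AM].
exists (\sum_(i < n) (`|y| + M) ^+ 2) => v Av.
rewrite sqnormE; apply: ler_sum => i _.
rewrite -ler_sqrt ?sqr_ge0// !sqrtr_sqr.
rewrite [leRHS]ger0_norm ?addr_ge0 ?(ltW M0)//.
apply: (@le_trans _ _ `|y - v|).
  rewrite [leRHS]/Num.norm/= mx_normrE; apply/bigmax_geP; right => /=.
  by exists (0, i) => //=; rewrite !mxE.
apply: (le_trans (ler_normB y v)); rewrite lerD2l; exact: AM.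
Qed.

End dot.

Section descent.
Variables (n m : nat) (F : 'rV[R]_n -> 'rV[R]_m -> R).

Lemma saa_ge (Cl : R) (u : nat -> 'rV[R]_m) (N : nat) (x : 'rV[R]_n) :
  (0 < N)%N -> (forall x u, Cl <= F x u) -> Cl <= saa F u N x.
Proof.
move=> N0 FC; rewrite /saa mulrC ler_pdivlMr ?ltr0n// mulr_natr.
rewrite -[X in _ *+ X]card_ord -sumr_const.
by apply: ler_sum => i _.
Qed.

Lemma saa_le (c : R) (u : nat -> 'rV[R]_m) (N : nat) (x : 'rV[R]_n) :
  (0 < N)%N -> \sum_(i < N) F x (u i) <= N%:R * c -> saa F u N x <= c.
Proof. by move=> N0 le; rewrite /saa mulrC ler_pdivrMr ?ltr0n// mulrC. Qed.

Variables (h : nat -> R) (mB MB r beta gamma gammabar : R)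
  (x0 : 'rV[R]_n) (N0 : nat) (theta0 : R)
  (z zt : nat -> nat -> 'rV[R]_m) (N Nt : nat -> nat)
  (theta alpha : nat -> R) (p x : nat -> 'rV[R]_n)
  (Cl C0 C1 alphabar : R).
Hypotheses (F_ge : forall x u, Cl <= F x u)
  (N0_gt0 : (0 < N0)%N) (beta_gt0 : 0 < beta) (gamma_gt0 : 0 < gamma)
  (mB_gt0 : 0 < mB)
  (run : IR_NS F h mB MB r beta gamma gammabar x0 N0 theta0 z zt N Nt
           theta alpha p x)
  (C1_bound : forall n, \sum_(k < n) h (N k) <= C1)
  (C0_bound : saa F (z 0%N) N0 x0 <= C0)
  (alphabar_gt0 : 0 < alphabar) (alpha_ge : forall k, alphabar <= alpha k).

Local Notation cap := (C0 + beta * C1).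
Local Notation a k := (saa F (zt k.+1) (Nt k.+1) (x k)).
Local Notation Y k := (saa F (z k) (N k) (x k)).
Local Notation U k := (saa F (z k.+1) (N k.+1) (x k)).
Local Notation q k := (sqnorm (x k.+1 - x k)).

Lemma run_N_gt0 k : (0 < N k)%N.
Proof.
case: run => _ N00 _ step; case: k => [|k]; first by rewrite N00.
by have [_ _ /andP[]] := step k.
Qed.

Lemma run_step_eq k : x k.+1 - x k = alpha k *: p k.
Proof.
have [_ _ _ /(_ k)[_ _ _ _ [_ _ _ _ ->]]] := run.
by rewrite addrAC subrr add0r.
Qed.

Lemma run_alpha_gt0 k : 0 < alpha k.
Proof. exact: lt_le_trans (alpha_ge k). Qed.

Lemma run_telescope k :
  Y k + gamma * (\sum_(j < k) alpha j * sqnorm (p j)) <=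
  C0 + beta * \sum_(j < k) h (N j).
Proof.
elim: k => [|k IH].
  by rewrite !big_ord0 !mulr0 !addr0; case: run => -> -> _ _.
have [_ _ _ /(_ k)[[_ _ R1] _ _ _ [_ R2 _ _ xk]]] := run.
rewrite !big_ord_recr/= xk; move: IH; lra.
Qed.

Lemma run_tilde_le k : a k <= cap.
Proof.
have [_ _ _ /(_ k)[[_ _ R1] _ _ _ _]] := run.
have Sp : 0 <= gamma * (\sum_(j < k) alpha j * sqnorm (p j)).
  rewrite mulr_ge0 ?(ltW gamma_gt0)// sumr_ge0// => i _.
  by rewrite mulr_ge0 ?sqnorm_ge0// ltW// run_alpha_gt0.
have := run_telescope k.
have : beta * \sum_(j < k.+1) h (N j) <= beta * C1 by rewrite ler_pM2l.
rewrite big_ord_recr/=; move: R1 Sp; lra.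
Qed.

Lemma run_current_saa_le k : Y k <= cap.
Proof.
have Sp : 0 <= gamma * (\sum_(j < k) alpha j * sqnorm (p j)).
  rewrite mulr_ge0 ?(ltW gamma_gt0)// sumr_ge0// => i _.
  by rewrite mulr_ge0 ?sqnorm_ge0// ltW// run_alpha_gt0.
have := run_telescope k.
have : beta * \sum_(j < k) h (N j) <= beta * C1 by rewrite ler_pM2l.
by move: Sp; lra.
Qed.

Lemma run_step_summable k : \sum_(j < k) q j <= (cap - Cl) / gamma.
Proof.
rewrite ler_pdivlMr//.
apply: (@le_trans _ _ (gamma * (\sum_(j < k) alpha j * sqnorm (p j)))).
  rewrite mulrC ler_pM2l//; apply: ler_sum => j _.
  rewrite run_step_eq sqnormZ ler_wpM2r ?sqnorm_ge0//.
  have [_ _ _ /(_ j)[_ _ _ _ [/andP[a0 a1] _ _ _ _]]] := run.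
  by rewrite expr2 ger_pMr.
have := run_telescope k.
have : beta * \sum_(j < k) h (N j) <= beta * C1 by rewrite ler_pM2l.
have := @saa_ge Cl (z k) _ (x k) (run_N_gt0 k) F_ge.
by lra.
Qed.

Lemma run_subgradient k : exists2 g,
  subdifferential (saa F (z k.+1) (N k.+1)) (x k) g &
  sqnorm g <= q k / (mB * alphabar) ^+ 2.
Proof.
have [_ _ _ /(_ k)[_ _ _ [B [B1 B2 [g [gs pE _]]]] _]] := run.
exists g => //.
have := sqnorm_le_loewner g mB_gt0 B1; rewrite -pE => gp.
rewrite ler_pdivlMr ?exprn_gt0 ?mulr_gt0// run_step_eq sqnormZ.
have -> : sqnorm g * (mB * alphabar) ^+ 2 =
          alphabar ^+ 2 * (mB ^+ 2 * sqnorm g) by ring.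
apply: (@le_trans _ _ (alpha k ^+ 2 * (mB ^+ 2 * sqnorm g))).
  rewrite ler_wpM2r ?(mulr_ge0 (sqr_ge0 _) (sqnorm_ge0 _))//.
  by apply: lerXn2r => //; rewrite nnegrE ltW// run_alpha_gt0.
by rewrite ler_wpM2l ?sqr_ge0.
Qed.

Lemma run_near_optimality k (y : 'rV[R]_n) (s : R) : 0 < s ->
  U k <= saa F (z k.+1) (N k.+1) y +
         (s * (q k / (mB * alphabar) ^+ 2) + sqnorm (y - x k) / s) / 2.
Proof.
move=> s0; have [g gs gq] := run_subgradient k.
have := gs y; have := dotv_young g (y - x k) s0.
have : s * sqnorm g <= s * (q k / (mB * alphabar) ^+ 2) by rewrite ler_pM2l.
lra.
Qed.

Lemma run_next_saa_le k : U k <= cap +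
  ((mB * alphabar) ^- 2 + 1) / 2 * ((cap - Cl) / gamma).
Proof.
have qS : q k <= (cap - Cl) / gamma.
  apply: le_trans (run_step_summable k.+1); rewrite big_ord_recr/=.
  by rewrite lerDr sumr_ge0// => i _; rewrite sqnorm_ge0.
have := run_near_optimality k (x k.+1) ltr01.
have := run_current_saa_le k.+1; rewrite divr1 mul1r.
have : ((mB * alphabar) ^- 2 + 1) / 2 * q k <=
    ((mB * alphabar) ^- 2 + 1) / 2 * ((cap - Cl) / gamma).
  by rewrite ler_wpM2l// divr_ge0// addr_ge0// invr_ge0 sqr_ge0.
lra.
Qed.

End descent.
End deterministic.

(** * A uniform one-sided law of large numbers *)

Section independence.
Local Open Scope ereal_scope.
Context d (T : measurableType d) (R : realType) (P : probability T R).

Definition same_law d' (T' : measurableType d') (X Y : T -> T') :=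
  forall A, measurable A -> P (X @^-1` A) = P (Y @^-1` A).

Definition independent d' (T' : measurableType d') (X Y : T -> T') :=
  forall A B, measurable A -> measurable B ->
    P (X @^-1` A `&` Y @^-1` B) = P (X @^-1` A) * P (Y @^-1` B).

Lemma same_law_integral d' (T' : measurableType d') (X Y : {mfun T >-> T'})
    (f : T' -> \bar R) :
  same_law X Y -> measurable_fun [set: T'] f -> (forall y, 0 <= f y) ->
  \int[P]_w f (X w) = \int[P]_w f (Y w).
Proof.
move=> XY mf f0.
rewrite -(ge0_integral_distribution X mf f0).
rewrite -(ge0_integral_distribution Y mf f0).
by apply: eq_measure_integral => A mA _; exact: XY.
Qed.

Lemma independent_integralM (X Y : {mfun T >-> R}) (g : R -> R) :
  independent X Y -> measurable_fun setT g -> (forall r, 0 <= g r)%R ->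
  \int[P]_w (g (X w) * g (Y w))%:E =
  \int[P]_w (g (X w))%:E * \int[P]_w (g (Y w))%:E.
Proof.
move=> XY mg g0.
have mXY : measurable_fun setT (fun w => (X w, Y w)).
  by apply: measurable_fun_pair.
pose XY' : {mfun T >-> (R * R)%type} := mfun_Sub (mem_set mXY).
have mgE : measurable_fun setT (EFin \o g) by exact/measurable_EFinP.
pose f (z : R * R) := (g z.1 * g z.2)%:E.
have mf : measurable_fun setT f.
  apply/measurable_EFinP; apply: measurable_funM.
    exact: measurableT_comp mg measurable_fst.
  exact: measurableT_comp mg measurable_snd.
have f0 z : 0 <= f z by rewrite lee_fin mulr_ge0.
have := ge0_integral_distribution XY' mf f0.
rewrite /comp /= => <-.
transitivity (\int[(distribution P X) \x (distribution P Y)]_z f z).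
  apply/esym/eq_measure_integral => A mA _.
  apply: (product_measure_unique (m' := distribution P XY') _ mA).
  by move=> B C mB mC; rewrite -[RHS](XY _ _ mB mC).
rewrite fubini_tonelli1//= /fubini_F /f/=.
under eq_integral => x _.
  rewrite (_ : \int[_]_y _ = (g x)%:E * \int[distribution P Y]_y (g y)%:E); last first.
    rewrite -ge0_integralZl_EFin//; last by move=> y _; rewrite lee_fin.
  over.
rewrite ge0_integralZr//=; last 2 first.
- by move=> x _; rewrite lee_fin.
- by apply: integral_ge0 => x _; rewrite lee_fin.
rewrite (ge0_integral_distribution X mgE)//.
by rewrite (ge0_integral_distribution Y mgE).
Qed.

Lemma ge0_markov (f : T -> R) (c : R) : measurable_fun setT f ->
  (forall w, 0 <= f w)%R -> (0 < c)%R ->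
  c%:E * P [set w | (c <= f w)%R] <= \int[P]_w (f w)%:E.
Proof.
move=> mf f0 c0.
pose f' : {mfun T >-> R} := mfun_Sub (mem_set mf).
have := @markov _ _ _ P f' id c c0 (@measurable_id _ _ _) (fun r h => h)
  (fun x y _ _ h => h).
rewrite unlock /=.
rewrite (_ : [set x | _] = [set w | (c <= f w)%R]); last first.
  by apply/seteqP; split => w/=; rewrite lee_fin ger0_norm.
by under eq_integral do rewrite ger0_norm//.
Qed.

Lemma sum_tail_le (k : nat) (Y : nat -> T -> R) (mu v e : R) :
  (0 < k)%N -> (0 < e)%R -> (0 <= mu)%R -> (0 <= v)%R ->
  (forall i, measurable_fun setT (Y i)) -> (forall i w, 0 <= Y i w)%R ->
  (forall i, \int[P]_w (Y i w)%:E = mu%:E) ->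
  (forall i j,
    \int[P]_w (Y i w * Y j w)%:E <= ((i == j)%:R * v + mu ^+ 2)%:E) ->
  P [set w | (k%:R * (mu + e) < \sum_(i < k) Y i w)%R] <=
    (v / (k%:R * e ^+ 2))%:E.
Proof.
move=> k0 e0 mu0 v0 mY Y0 EY EYY.
have kR0 : (0 < k%:R :> R)%R by rewrite ltr0n.
pose S w := (\sum_(i < k) Y i w)%R.
have mS : measurable_fun setT S by exact: measurable_sum.
have S0 w : (0 <= S w)%R by apply: sumr_ge0.
have ES : \int[P]_w (S w)%:E = (k%:R * mu)%:E.
  under eq_integral => w _ do rewrite /S -sumEFin.
  rewrite ge0_integral_sum//; last 2 first.
    by move=> i; exact/measurable_EFinP.
    by move=> i w _; rewrite lee_fin.
  under eq_bigr => i _ do rewrite EY.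
  by rewrite sumEFin sumr_const card_ord mulr_natl.
have ESS : \int[P]_w (S w ^+ 2)%:E <= (k%:R * v + k%:R ^+ 2 * mu ^+ 2)%:E.
  under eq_integral => w _.
    rewrite expr2 /S big_distrlr/= -sumEFin.
    under eq_bigr do rewrite -sumEFin.
    over.
  rewrite ge0_integral_sum//; last 2 first.
    move=> i; apply: emeasurable_sum => j.
    by apply/measurable_EFinP/measurable_funM.
    by move=> i w _; rewrite sume_ge0// => j _; rewrite lee_fin mulr_ge0.
  apply: (@le_trans _ _
    (\sum_(i < k) \sum_(j < k) ((i == j)%:R * v + mu ^+ 2)%:E)).
    apply: lee_sum => i _; rewrite ge0_integral_sum//; last 2 first.
      by move=> j; apply/measurable_EFinP/measurable_funM.
      by move=> j w _; rewrite lee_fin mulr_ge0.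
    by apply: lee_sum => j _; exact: EYY.
  under eq_bigr do rewrite sumEFin.
  rewrite sumEFin lee_fin.
  rewrite (eq_bigr (fun=> v + k%:R * mu ^+ 2)%R); last first.
    move=> i _; rewrite big_split/= sumr_const card_ord mulr_natl.
    congr (_ + _)%R; rewrite (bigD1 i)//= eqxx mul1r big1 ?addr0// => j ji.
    by rewrite eq_sym (negbTE ji) mul0r.
  by rewrite sumr_const card_ord -[leLHS]mulr_natl; rewrite le_eqVlt; apply/orP; left; apply/eqP; ring.
pose f w := ((S w - k%:R * mu) ^+ 2)%R.
have mf : measurable_fun setT f.
  by apply: measurable_funX; apply: measurable_funB.
have Ef : \int[P]_w (f w)%:E <= (k%:R * v)%:E.
  have : \int[P]_w (f w)%:E + (2 * (k%:R * mu))%:E * \int[P]_w (S w)%:E =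
         \int[P]_w (S w ^+ 2)%:E + ((k%:R * mu) ^+ 2)%:E.
    rewrite -ge0_integralZl_EFin//; last 3 first.
      by move=> w _; rewrite lee_fin.
      exact/measurable_EFinP.
      by rewrite !mulr_ge0.
    rewrite -ge0_integralD//; last 4 first.
      by move=> w _; rewrite lee_fin sqr_ge0.
      exact/measurable_EFinP.
      by move=> w _; rewrite -EFinM lee_fin !mulr_ge0.
      by apply/measurable_EFinP/measurable_funM.
    have -> : ((k%:R * mu) ^+ 2)%:E = \int[P]_w ((k%:R * mu) ^+ 2)%:E.
      by rewrite integral_cst//= probability_setT mule1.
    rewrite -ge0_integralD//; last 3 first.
      by move=> w _; rewrite lee_fin sqr_ge0.
      by apply/measurable_EFinP/measurable_funX.
      by move=> w _; rewrite lee_fin sqr_ge0.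
    apply: eq_integral => w _; rewrite -EFinM -!EFinD; congr EFin.
    by rewrite /f; ring.
  rewrite ES -EFinM => eqf.
  rewrite -(@leeD2rE _ (2 * (k%:R * mu) * (k%:R * mu))%:E)// eqf.
  apply: (le_trans (leeD2r _ ESS)).
  by rewrite -!EFinD lee_fin; rewrite le_eqVlt; apply/orP; left; apply/eqP; ring.
have ke0 : (0 < (k%:R * e) ^+ 2)%R by rewrite exprn_gt0// mulr_gt0.
have := ge0_markov mf (fun w => sqr_ge0 _) ke0.
move=> /le_trans /(_ Ef) mk.
apply: (@le_trans _ _ (P [set w | ((k%:R * e) ^+ 2 <= f w)%R])).
  apply: le_measure; rewrite ?inE.
  - rewrite -[X in measurable X]setTI.
    rewrite (_ : _ `&` _ = setT `&` (fun w => (k%:R * (mu + e) < S w)%R) @^-1` [set true]).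
      by apply: measurable_fun_ltr.
    by apply/seteqP; split.
  - rewrite -[X in measurable X]setTI; exact: measurable_fun_le.
  - move=> w /= lt; rewrite /f; apply: lerXn2r.
    + by rewrite nnegrE mulr_ge0// ltW.
    + rewrite nnegrE; move: lt; rewrite mulrDr -/(S w) => lt.
      by rewrite subr_ge0 ltW// (le_lt_trans _ lt)// lerDl mulr_ge0// ltW.
    + by rewrite lerBrDl -mulrDr ltW.
rewrite -(@lee_pmul2l _ ((k%:R * e) ^+ 2)%:E)// (le_trans mk)// -EFinM lee_fin.
rewrite le_eqVlt; apply/orP; left; apply/eqP.
by field; rewrite !gt_eqF.
Qed.

End independence.

Section lln.
Local Open Scope ereal_scope.
Context d (T : measurableType d) (R : realType) (P : probability T R).

Definition clip (t r : R) : R := Num.min (Num.max r 0%R) t.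

Lemma clip_ge0 t r : (0 <= t)%R -> (0 <= clip t r)%R.
Proof. by move=> t0; rewrite /clip le_min t0 le_max lexx orbT. Qed.

Lemma clip_le t r : (0 <= r)%R -> (clip t r <= r)%R.
Proof. by move=> r0; rewrite /clip ge_min max_l ?lexx. Qed.

Lemma clip_le_bound t r : (clip t r <= t)%R.
Proof. by rewrite /clip ge_min lexx orbT. Qed.

Lemma clip_id t r : (0 <= r)%R -> (r <= t)%R -> clip t r = r.
Proof. by move=> r0 rt; rewrite /clip max_l// min_l. Qed.

Lemma measurable_clip t : measurable_fun setT (clip t).
Proof. by apply: measurable_minr => //; apply: measurable_maxr. Qed.

Lemma measurable_gt_fun (f : T -> R) (c : R) : measurable_fun setT f ->
  measurable [set w | (c < f w)%R].
Proof.
move=> mf; rewrite -[X in measurable X]setTI.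
rewrite (_ : _ `&` _ = setT `&` (fun w => (c < f w)%R) @^-1` [set true]).
  by apply: measurable_fun_ltr.
by apply/seteqP; split.
Qed.

(* Etemadi's truncation: the summands are cut at level [t], which costs
   [P (X0 > t)] for each of them and leaves a bounded second moment. *)
Lemma iid_sum_tail_le (X0 : {mfun T >-> R}) (X : nat -> {mfun T >-> R})
    (mu v t e : R) (k : nat) :
  (0 < k)%N -> (0 < e)%R -> (0 < t)%R ->
  (forall w, 0 <= X0 w)%R -> (forall i w, 0 <= X i w)%R ->
  (forall i, same_law P (X i) X0) ->
  (forall i j, i != j -> independent P (X i) (X j)) ->
  \int[P]_w (X0 w)%:E = mu%:E ->
  \int[P]_w (clip t (X0 w) ^+ 2)%:E = v%:E ->
  P [set w | (k%:R * (mu + e) < \sum_(i < k) X i w)%R] <=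
    ((k%:R / t ^+ 2 + (k%:R * e ^+ 2)^-1) * v)%:E.
Proof.
move=> k0 e0 t0 X00 XX0 Xlaw Xind EX EC.
have mclip := measurable_clip t.
have ct0 r : (0 <= clip t r)%R by apply: clip_ge0; exact: ltW.
have v0 : (0 <= v)%R.
  rewrite -lee_fin -EC; apply: integral_ge0 => w _.
  by rewrite lee_fin sqr_ge0.
have mct (f : {mfun T >-> R}) : measurable_fun setT (fun w => clip t (f w)).
  exact: (measurableT_comp (@measurable_clip t)).
have [mu' [EC1 mu'0 mu'mu]] : exists mu', [/\
    \int[P]_w (clip t (X0 w))%:E = mu'%:E, (0 <= mu')%R & (mu' <= mu)%R].
  have i0 : 0 <= \int[P]_w (clip t (X0 w))%:E.
    by apply: integral_ge0 => w _; rewrite lee_fin.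
  have il : \int[P]_w (clip t (X0 w))%:E <= mu%:E.
    rewrite -EX; apply: ge0_le_integral => //.
    - by move=> w _; rewrite lee_fin.
    - exact/measurable_EFinP.
    - exact/measurable_EFinP.
    - by move=> w _; rewrite lee_fin clip_le.
  have ifin : \int[P]_w (clip t (X0 w))%:E \is a fin_num.
    by rewrite ge0_fin_numE// (le_lt_trans il)// ltry.
  exists (fine (\int[P]_w (clip t (X0 w))%:E)).
  by rewrite fineK// -!lee_fin fineK.
have lawC i (g : R -> R) : measurable_fun setT g -> (forall r, 0 <= g r)%R ->
    \int[P]_w (g (X i w))%:E = \int[P]_w (g (X0 w))%:E.
  move=> mg g0; apply: (@same_law_integral _ _ _ _ _ _ (X i) X0 (EFin \o g)) => //.
  exact/measurable_EFinP.
pose B := [set w | (k%:R * (mu' + e) < \sum_(i < k) clip t (X i w))%R].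
have PB : P B <= (v / (k%:R * e ^+ 2))%:E.
  apply: (@sum_tail_le _ _ _ _ _ (fun i w => clip t (X i w))) => //.
  - by move=> i; rewrite (lawC i (clip t)).
  - move=> i j; have [->|ij] := eqVneq i j.
      under eq_integral do rewrite -expr2.
      rewrite (lawC j (fun r => clip t r ^+ 2)%R)//.
      - by rewrite EC mul1r lee_fin lerDl sqr_ge0.
      - exact: measurable_funX.
      - by move=> r; rewrite sqr_ge0.
    rewrite (independent_integralM (Xind _ _ ij))//.
    by rewrite !(lawC _ (clip t))// EC1 -EFinM mul0r add0r expr2.
pose D i := [set w | (t < X i w)%R].
have mD i : measurable (D i) by exact: measurable_gt_fun.
have PD i : P (D i) <= (v / t ^+ 2)%:E.
  have -> : P (D i) = P [set w | (t < X0 w)%R].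
    have := Xlaw i _ (measurable_itv `]t, +oo[%R).
    have pre (Z : T -> R) : Z @^-1` `]t, +oo[ = [set w | (t < Z w)%R].
      by apply/seteqP; split => w/=; rewrite in_itv/= andbT.
    by rewrite !pre.
  have mk := @ge0_markov _ _ _ P (fun w => clip t (X0 w) ^+ 2)%R (t ^+ 2)%R
    (measurable_funX 2 (mct X0)) (fun w => sqr_ge0 _) (exprn_gt0 2 t0).
  rewrite EC in mk.
  apply: (@le_trans _ _ (P [set w | (t ^+ 2 <= clip t (X0 w) ^+ 2)%R])).
    apply: le_measure; rewrite ?inE.
    - exact: measurable_gt_fun.
    - rewrite -[X in measurable X]setTI.
      by apply: measurable_fun_le => //; apply: measurable_funX.
    - move=> w /= tw; rewrite (_ : clip t (X0 w) = t)//.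
      by rewrite /clip max_l// min_r// ltW.
  rewrite -(@lee_pmul2l _ (t ^+ 2)%:E)//; last by rewrite lte_fin exprn_gt0.
  rewrite (le_trans mk)// -EFinM lee_fin mulrCA divff ?mulr1//.
  by rewrite gt_eqF// exprn_gt0.
pose A := [set w | (k%:R * (mu + e) < \sum_(i < k) X i w)%R].
have mA : measurable A.
  by apply: measurable_gt_fun; apply: measurable_sum.
have mB : measurable B.
  by apply: measurable_gt_fun; apply: measurable_sum => i; exact: mct.
have mUD : measurable (\big[setU/set0]_(i < k) D i).
  exact: bigsetU_measurable.
apply: (@le_trans _ _ (P (B `|` \big[setU/set0]_(i < k) D i))).
  apply: le_measure; rewrite ?inE//; first exact: measurableU.
  move=> w Aw; have [Dw|nDw] := pselect ((\big[setU/set0]_(i < k) D i) w).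
    by right.
  left; rewrite /B/=; apply: (@le_lt_trans _ _ (k%:R * (mu + e))%R).
    by rewrite ler_wpM2l// lerD2r.
  rewrite (lt_le_trans Aw)//; apply: ler_sum => i _.
  rewrite clip_id//; rewrite leNgt; apply/negP => Di; apply: nDw.
  by rewrite -bigcup_mkord; exists i => //=.
apply: (le_trans (measureU2 _ mB mUD)).
rewrite mulrDl EFinD addeC; apply: leeD; first by rewrite mulrC.
apply: (@le_trans _ _ (\sum_(i < k) P (D i))).
  exact: (@Boole_inequality _ _ _ P (fun i => D i)).
apply: (@le_trans _ _ (\sum_(i < k) (v / t ^+ 2)%:E)).
  by apply: lee_sum => i _.
rewrite sumEFin sumr_const card_ord lee_fin -[leLHS]mulr_natl.
by rewrite le_eqVlt; apply/orP; left; apply/eqP; ring.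
Qed.

Lemma dyadic_clip_sum (r : R) (n : nat) : (0 <= r)%R ->
  (\sum_(m < n) clip (2 ^+ m) r ^+ 2 / 2 ^+ m <= 4 * r)%R.
Proof.
move=> r0.
have p2 k : (0 < 2 ^+ k :> R)%R by rewrite exprn_gt0.
suff : ((2 ^+ n <= r)%R ->
    \sum_(m < n) clip (2 ^+ m) r ^+ 2 / 2 ^+ m <= 2 ^+ n)%R /\
   ((r < 2 ^+ n)%R ->
    \sum_(m < n) clip (2 ^+ m) r ^+ 2 / 2 ^+ m <= 4 * r - 2 * (r ^+ 2 / 2 ^+ n))%R.
  move=> [h1 h2]; have [le|lt] := leP (2 ^+ n)%R r.
    by rewrite (le_trans (h1 le))//; lra.
  apply: (le_trans (h2 lt)); rewrite gerBl.
  by rewrite mulr_ge0// (divr_ge0 (sqr_ge0 _) (ltW (p2 n))).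
elim: n => [|n [IH1 IH2]].
  rewrite !big_ord0 expr0 divr1; split => //; nra.
rewrite !big_ord_recr/=; set t : R := (2 ^+ n)%R in IH1 IH2 *.
have t0 : (0 < t)%R by exact: p2.
have tS : (2 ^+ n.+1 = 2 * t)%R by rewrite exprS.
have tdiv : (r ^+ 2 / (2 * t) = (r ^+ 2 / t) / 2)%R.
  by field; rewrite gt_eqF.
rewrite tS tdiv; have [le|lt] := leP t r.
  have -> : (clip t r ^+ 2 / t = t)%R.
    rewrite (_ : clip t r = t); first by field; rewrite gt_eqF.
    by rewrite /clip max_l// min_r.
  have := IH1 le; split => [|rt]; first lra.
  have rtt : (r ^+ 2 / t <= 4 * r - 2 * t)%R by rewrite ler_pdivrMr//; nra.
  lra.
have -> : (clip t r ^+ 2 / t = r ^+ 2 / t)%R by rewrite clip_id// ltW.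
have := IH2 lt; split => [|_]; lra.
Qed.

(* Every large [n] satisfies [l 2^m <= n < (l + 1) 2^m] with [L <= l < 2L], and
   the sum of the nonnegative terms up to [n] is at most the one up to
   [(l + 1) 2^m <= n (1 + 1/L)]; so it suffices to control these block ends. *)
Lemma lln_upper (X0 : {mfun T >-> R}) (mu eps delta : R) :
  (forall w, 0 <= X0 w)%R -> \int[P]_w (X0 w)%:E = mu%:E ->
  (0 < eps)%R -> (0 < delta)%R ->
  exists2 M, (0 < M)%N & forall X : nat -> {mfun T >-> R},
    (forall i w, 0 <= X i w)%R ->
    (forall i, same_law P (X i) X0) ->
    (forall i j, i != j -> independent P (X i) (X j)) ->
    P (\bigcup_(n in [set n | (M <= n)%N])
        [set w | (n%:R * (mu + eps) < \sum_(i < n) X i w)%R]) <= delta%:E.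
Proof.
move=> X00 EX eps0 delta0.
have mu0 : (0 <= mu)%R.
  by rewrite -lee_fin -EX; apply: integral_ge0 => w _; rewrite lee_fin.
pose e := (eps / 2)%R; have e0 : (0 < e)%R by rewrite divr_gt0.
have [L L0 eL] : exists2 L, (0 < L)%N & (mu + e <= L%:R * e)%R.
  exists (Num.bound ((mu + e) / e)) => //.
  rewrite -ler_pdivrMr// ltW// archi_boundP//.
  by rewrite divr_ge0// ?addr_ge0// ltW.
have p2 k : (0 < 2 ^+ k :> R)%R by rewrite exprn_gt0.
have mct t : measurable_fun setT (fun w => clip t (X0 w)).
  exact: (measurableT_comp (@measurable_clip t)).
pose q m w : \bar R := (clip (2 ^+ m) (X0 w) ^+ 2 / 2 ^+ m)%:E.
have q0 m w : 0 <= q m w.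
  by rewrite lee_fin divr_ge0 ?sqr_ge0// ltW.
have mq m : measurable_fun setT (q m).
  apply/measurable_EFinP; apply: measurable_funM => //.
  exact: measurable_funX.
pose G m := \int[P]_w q m w.
have G0 m : 0 <= G m by apply: integral_ge0 => w _; exact: q0.
have Gfin : \sum_(0 <= m <oo) G m < +oo.
  rewrite -integral_nneseries//.
  apply: (@le_lt_trans _ _ (\int[P]_w (4%:E * (X0 w)%:E))).
    apply: ge0_le_integral => //.
    - by move=> w _; apply: nneseries_ge0.
    - by apply: ge0_emeasurable_sum => // m w _ _; exact: q0.
    - by apply/measurable_EFinP/measurable_funM.
    - move=> w _; apply: lime_le; first exact: is_cvg_nneseries.
      apply: nearW => n; rewrite big_mkord sumEFin lee_fin.
      exact: dyadic_clip_sum.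
  rewrite ge0_integralZl_EFin//; first by rewrite EX -EFinM ltry.
    by move=> w _; rewrite lee_fin.
  exact/measurable_EFinP.
pose K : R := (\sum_(l < 2 * L) (l.+1%:R + (e ^+ 2)^-1))%R.
have K0 : (0 <= K)%R by apply: sumr_ge0 => l _; rewrite addr_ge0// invr_ge0 sqr_ge0.
have [m0 tailm0] : exists m0, \sum_(m0 <= m <oo) (K%:E * G m) <= delta%:E.
  have KGfin : \sum_(0 <= m <oo) (K%:E * G m) < +oo.
    rewrite nneseriesZl//.
    by rewrite lte_mul_pinfty.
  have KG0 m : 0 <= K%:E * G m by rewrite mule_ge0.
  have /= := nneseries_tail_cvg KGfin (fun m _ => KG0 m).
  move=> /(_ [set y | y <= delta%:E]) [].
    have : nbhs (0 : \bar R) [set y | y < delta%:E].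
      apply: open_nbhs_nbhs; split; first exact: open_ereal_lt_ereal.
      by rewrite /= lte_fin.
    by apply: filterS => y /= /ltW.
  by move=> m0 _ /(_ m0 (leqnn m0)); exists m0.
have Gv m : exists2 v, \int[P]_w (clip (2 ^+ m) (X0 w) ^+ 2)%:E = v%:E &
    G m = (v / 2 ^+ m)%:E.
  have i0 : 0 <= \int[P]_w (clip (2 ^+ m) (X0 w) ^+ 2)%:E.
    by apply: integral_ge0 => w _; rewrite lee_fin sqr_ge0.
  have il : \int[P]_w (clip (2 ^+ m) (X0 w) ^+ 2)%:E < +oo.
    apply: (@le_lt_trans _ _ (\int[P]_w ((2 ^+ m) ^+ 2)%:E)).
      apply: ge0_le_integral => //.
      - by move=> w _; rewrite lee_fin sqr_ge0.
      - by apply/measurable_EFinP/measurable_funX.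
      - move=> w _; rewrite lee_fin; apply: lerXn2r => //.
          by rewrite nnegrE clip_ge0// ltW.
          by rewrite nnegrE ltW.
        exact: clip_le_bound.
    by rewrite integral_cst//= probability_setT mule1 ltry.
  have := il; rewrite -ge0_fin_numE// => ifin.
  exists (fine (\int[P]_w (clip (2 ^+ m) (X0 w) ^+ 2)%:E)).
    by rewrite fineK.
  rewrite EFinM fineK// /G /q muleC.
  under eq_integral do rewrite mulrC EFinM.
  rewrite ge0_integralZl_EFin//.
  - by move=> w _; rewrite lee_fin sqr_ge0.
  - by apply/measurable_EFinP/measurable_funX.
exists (L * 2 ^ m0)%N; first by rewrite muln_gt0 L0 expn_gt0.
move=> X X0' Xlaw Xind.
have mS n : measurable_fun setT (fun w => \sum_(i < n) X i w)%R.
  exact: measurable_sum.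
pose block k := [set w | (k%:R * (mu + e) < \sum_(i < k) X i w)%R].
have mblock k : measurable (block k) by exact: measurable_gt_fun.
pose F m := \big[setU/set0]_(l < 2 * L) block (l.+1 * 2 ^ m)%N.
have mF m : measurable (F m).
  by apply: bigsetU_measurable => l _.
have PF m : P (F m) <= K%:E * G m.
  apply: (le_trans (@Boole_inequality _ _ _ P (fun l => block (l.+1 * 2 ^ m)%N) _ _)) => //.
  have [v vE ->] := Gv m.
  have v0 : (0 <= v)%R.
    by rewrite -lee_fin -vE; apply: integral_ge0 => w _; rewrite lee_fin sqr_ge0.
  rewrite -EFinM /K mulr_suml -sumEFin; apply: lee_sum => l _.
  have kp : (0 < l.+1 * 2 ^ m)%N by rewrite muln_gt0 expn_gt0.
  apply: (le_trans (iid_sum_tail_le kp e0 (p2 m) X00 X0' Xlaw Xind EX vE)).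
  rewrite lee_fin natrM natrX; set t : R := (2 ^+ m)%R.
  have t0 : (0 < t)%R by exact: p2.
  rewrite [leRHS]mulrCA [leRHS]mulrC ler_wpM2r//.
  have -> : (l.+1%:R * t / t ^+ 2 = l.+1%:R / t)%R by field; rewrite gt_eqF.
  rewrite mulrDl lerD2l -invfM lef_pV2 ?posrE ?mulr_gt0 ?exprn_gt0 ?ltr0n//.
  by rewrite [leLHS]mulrC ler_wpM2r ?sqr_ge0// ler_peMl ?(ltW t0)// ler1n.
have sub : \bigcup_(n in [set n | (L * 2 ^ m0 <= n)%N])
    [set w | (n%:R * (mu + eps) < \sum_(i < n) X i w)%R] `<=`
    \bigcup_(m in ~` `I_m0) F m.
  move=> w [n /= Ln Sn].
  pose m := trunc_log 2 (n %/ L).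
  have nL0 : (2 ^ m0 <= n %/ L)%N by rewrite leq_divRL// mulnC.
  have nLgt0 : (0 < n %/ L)%N by rewrite (leq_trans _ nL0)// expn_gt0.
  have m0m : (m0 <= m)%N by rewrite trunc_log_max.
  have /andP[lem ltm] : (2 ^ m <= n %/ L < 2 ^ m.+1)%N by apply: trunc_log_bounds.
  have Lm : (L * 2 ^ m <= n)%N by move: lem; rewrite leq_divRL// mulnC.
  have nlt : (n < 2 * L * 2 ^ m)%N.
    by move: ltm; rewrite ltn_divLR// expnS; lia.
  have p2m : (0 < 2 ^ m)%N by rewrite expn_gt0.
  have l2L : (n %/ 2 ^ m < 2 * L)%N by rewrite ltn_divLR.
  exists m; first by rewrite /= ltnNge m0m.
  rewrite /F -(bigcup_mkord _ (fun l => block (l.+1 * 2 ^ m)%N)); exists (n %/ 2 ^ m)%N => //=.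
  have nk : (n <= (n %/ 2 ^ m).+1 * 2 ^ m)%N by rewrite ltnW// -ltn_divLR.
  have kn : ((n %/ 2 ^ m).+1 * 2 ^ m <= n + 2 ^ m)%N.
    by rewrite mulSn addnC leq_add2r leq_divM.
  set k := (_.+1 * _)%N in nk kn *.
  rewrite /block/=; apply: (@le_lt_trans _ _ (n%:R * (mu + eps))%R); last first.
    rewrite (lt_le_trans Sn)// -!(big_mkord xpredT (fun i => X i w)).
    by rewrite (big_cat_nat (leq0n n) nk)//= lerDl sumr_ge0.
  have knR : (k%:R <= n%:R + 2 ^+ m :> R)%R by rewrite -natrX -natrD ler_nat.
  have LmR : (L%:R * 2 ^+ m <= n%:R :> R)%R by rewrite -natrX -natrM ler_nat.
  apply: (@le_trans _ _ ((n%:R + 2 ^+ m) * (mu + e))%R).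
    by rewrite ler_wpM2r// addr_ge0// ltW.
  have h1 : (2 ^+ m * (mu + e) <= 2 ^+ m * (L%:R * e))%R by rewrite ler_wpM2l// ltW.
  have h2 : (L%:R * 2 ^+ m * e <= n%:R * e)%R by rewrite ler_wpM2r// ltW.
  have -> : eps = (e + e)%R by rewrite /e; lra.
  lra.
have mbad : measurable (\bigcup_(n in [set n | (L * 2 ^ m0 <= n)%N])
    [set w | (n%:R * (mu + eps) < \sum_(i < n) X i w)%R]).
  by apply: bigcup_measurable => n _; exact: measurable_gt_fun.
apply: (le_trans (measure_sigma_subadditive_tail P mF mbad sub)).
apply: le_trans tailm0; apply: lee_nneseries => m *; first exact: measure_ge0.
exact: PF.
Qed.

End lln.

(** * Expectations and the objective *)

Section measure_complements.
Local Open Scope ereal_scope.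
Context d (T : measurableType d) (R : realType) (P : probability T R).

Lemma integral_shift (X : T -> R) (c : R) : measurable_fun setT X ->
  (0 <= c)%R -> (forall w, - c <= X w)%R ->
  \int[P]_w (X w)%:E = \int[P]_w (X w + c)%:E - c%:E.
Proof.
move=> mX c0 Xc.
have mXE : measurable_fun setT (EFin \o X) by exact/measurable_EFinP.
have mXc : measurable_fun setT (fun w => (X w + c)%R) by exact: measurable_funD.
set I := \int[P]_w (X w + c)%:E.
have In : \int[P]_w ((EFin \o X)^\- w) <= c%:E.
  apply: (@le_trans _ _ (\int[P]_w (cst c%:E w))).
    apply: ge0_le_integral => //.
    - exact: measurable_funeneg.
    - move=> w _; rewrite funenegE/= -EFin_max.
      by rewrite lee_fin ge_max c0 andbT lerNl.
  by rewrite integral_cst//= probability_setT mule1.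
have In0 : 0 <= \int[P]_w ((EFin \o X)^\- w) by exact: integral_ge0.
have Infin : \int[P]_w ((EFin \o X)^\- w) \is a fin_num.
  by rewrite ge0_fin_numE// (le_lt_trans In)// ltry.
have eqI : I + \int[P]_w ((EFin \o X)^\- w) = \int[P]_w ((EFin \o X)^\+ w) + c%:E.
  have -> : c%:E = \int[P]_w (cst c%:E w).
    by rewrite integral_cst//= probability_setT mule1.
  rewrite /I -ge0_integralD//; last 3 first.
  - by move=> w _; rewrite lee_fin -lerBlDr sub0r.
  - exact/measurable_EFinP.
  - exact: measurable_funeneg.
  rewrite -ge0_integralD//; last exact: measurable_funepos.
  apply: eq_integral => w _.
  have /(congr1 (fun g => g w)) := funeposneg (EFin \o X).
  rewrite /= funeposE funenegE/= -!EFin_max -EFinD => -[eX].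
  by rewrite -!EFinD; congr EFin; rewrite {1}eX; ring.
rewrite [LHS]integralE.
rewrite -[X in X - _ = _](@addeK _ c%:E)// -eqI.
by rewrite addeAC addeK.
Qed.

Lemma ae_le_cond_expectation (G : set (set T)) (Y Z : T -> \bar R) (c : R) :
  is_cond_expectation P G Y Z -> {ae P, forall w, Y w <= c%:E} ->
  {ae P, forall w, Z w <= c%:E}.
Proof.
move=> [iY iZ GZ eqYZ] Yc.
have mZ := measurable_int P iZ.
pose A := Z @^-1` [set` `]c%:E, +oo]].
have mI : measurable [set` `]c%:E, +oo]] by exact: emeasurable_itv.
have mA : measurable A by rewrite -[A]setTI; exact: mZ.
have icst : P.-integrable A (cst c%:E) by exact: finite_measure_integrable_cst.
have iZA : P.-integrable A Z by exact: integrableS iZ.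
have iYA : P.-integrable A Y by exact: integrableS iY.
have AZ w : A w -> c%:E < Z w by rewrite /A/= in_itv/= leey andbT.
have le0 : \int[P]_(w in A) (Z w - c%:E) <= 0.
  have iB := integrableB mA icst iYA.
  have : 0 <= \int[P]_(w in A) ((cst c%:E \- Y) w).
    have -> : \int[P]_(w in A) ((cst c%:E \- Y) w) =
              \int[P]_(w in A) (cst c%:E \- Y)^\+ w.
      apply: ae_eq_integral => //.
      - exact: (measurable_int P iB).
      - by apply: measurable_funepos; exact: (measurable_int P iB).
      - apply: filterS Yc => w Yw _; rewrite funeposE max_l//.
        by have := Yw; rewrite /cst/= -(@sube_ge0 _ (Y w) c%:E) ?orbT.
    by apply: integral_ge0 => w _; exact: funepos_ge0.
  have -> : \int[P]_(w in A) ((cst c%:E \- Y) w) =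
    \int[P]_(w in A) cst c%:E w - \int[P]_(w in A) Y w := integralB mA icst iYA.
  rewrite sube_ge0; last by apply/orP; right; exact: integrable_fin_num.
  have -> : \int[P]_(w in A) (Z w - c%:E) =
    \int[P]_(w in A) Z w - \int[P]_(w in A) cst c%:E w := integralB mA iZA icst.
  by rewrite sube_le0 (eqYZ _ (GZ _ mI)).
have iZc := integrableB mA iZA icst.
have : \int[P]_(w in A) `|(Z \- cst c%:E) w| = 0.
  apply/eqP; rewrite eq_le integral_ge0// andbT.
  rewrite (le_trans _ le0)// le_eqVlt; apply/orP; left; apply/eqP.
  apply: eq_integral => w; rewrite inE => Aw.
  by rewrite gee0_abs// [X in 0 <= X](_ : _ = Z w - c%:E)// sube_ge0// ltW// AZ.
move=> /(ae_eq_integral_abs P mA (measurable_int P iZc)).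
apply: filterS => w h; rewrite leNgt; apply/negP => cZ.
have Aw : A w by rewrite /A/= in_itv/= cZ leey.
have Zc0 : Z w - c%:E = 0 := h Aw.
by move: cZ; rewrite -[Z w](@subeK _ _ c%:E)// Zc0 add0e ltxx.
Qed.

Lemma summable_integral_le (V : nat -> T -> R) (c e : R) : (0 < e)%R ->
  (forall k, measurable_fun setT (V k)) -> (forall k w, 0 <= V k w)%R ->
  {ae P, forall w, forall n, (\sum_(k < n) V k w <= c)%R} ->
  exists K, forall k, (K <= k)%N -> \int[P]_w (V k w)%:E <= e%:E.
Proof.
move=> e0 mV V0 Vc.
have iV0 k : 0 <= \int[P]_w (V k w)%:E.
  by apply: integral_ge0 => w _; rewrite lee_fin.
have fin : \sum_(0 <= k <oo) \int[P]_w (V k w)%:E < +oo.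
  rewrite -integral_nneseries//; last 2 first.
  - by move=> k; exact/measurable_EFinP.
  - by move=> k w _; rewrite lee_fin.
  apply: (@le_lt_trans _ _ (\int[P]_w (cst (Num.max c 0%R)%:E w))).
    apply: ae_ge0_le_integral => //.
    - by move=> w _; apply: nneseries_ge0 => *; rewrite lee_fin.
    - apply: ge0_emeasurable_sum => // [k w _ _|k _]; first by rewrite lee_fin.
      exact/measurable_EFinP.
    - by move=> w _; rewrite lee_fin le_max lexx orbT.
    - apply: filterS Vc => w Vcw _; apply: lime_le.
        by apply: is_cvg_nneseries => *; rewrite lee_fin.
      apply: nearW => n; rewrite big_mkord sumEFin lee_fin.
      by rewrite (le_trans (Vcw n))// le_max lexx.
  by rewrite integral_cst//= probability_setT mule1 ltry.
have := nneseries_tail_cvg fin (fun k _ => iV0 k).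
move=> /(_ [set y | y <= e%:E]) [].
  have : nbhs (0 : \bar R) [set y | y < e%:E].
    apply: open_nbhs_nbhs; split; first exact: open_ereal_lt_ereal.
    by rewrite /= lte_fin.
  by apply: filterS => y /= /ltW.
move=> K _ KP; exists K => k /KP/=; apply: le_trans.
have := @nneseries_lim_ge _ (fun k => \int[P]_w (V k w)%:E) xpredT k k.+1 (fun k _ _ => iV0 k).
by rewrite big_nat1.
Qed.

End measure_complements.

Section objective.
Context (R : realType) (d : measure_display) (Omega : measurableType d)
  (P : probability Omega R) (n m : nat).
Variables (F : 'rV[R]_n -> 'rV[R]_m -> R) (xi : Omega -> 'rV[R]_m) (c : R).
Hypotheses (xi_random : random_vector xi)
  (F_measurable : forall x, measurable_fun setT (F x : borelRn R m -> R))
  (F_continuous : forall u, continuous (F ^~ u))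
  (c_ge0 : 0 <= c) (F_ge : forall x u, - c <= F x u).

Let f := objective P F xi.

Lemma measurable_coord q (Z : Omega -> 'rV[R]_q) (i : 'I_q) :
  random_vector Z -> measurable_fun setT (fun w => Z w 0 i).
Proof.
move=> mZ.
have mc : @measurable_fun _ _ (borelRn R q) R setT (fun v : 'rV[R]_q => v 0 i).
  apply: (measurability (@RGenOInfty.G R)); first exact: RGenOInfty.measurableE.
  move=> _ [_ [a ->] <-]; rewrite setTI; apply: sub_sigma_algebra.
  by apply: open_comp; [move=> v _; exact: coord_continuous|exact: interval_open].
exact: (measurableT_comp mc mZ).
Qed.

Lemma measurable_sqnorm_sub q (Z Z' : Omega -> 'rV[R]_q) :
  random_vector Z -> random_vector Z' ->
  measurable_fun setT (fun w => sqnorm (Z w - Z' w)).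
Proof.
move=> mZ mZ'; under eq_fun do rewrite sqnormE.
apply: measurable_sum => i; apply: measurable_funX.
under eq_fun do rewrite !mxE.
by apply: measurable_funB; exact: measurable_coord.
Qed.

Lemma measurable_integrand (x : 'rV[R]_n) (Z : Omega -> 'rV[R]_m) :
  random_vector Z -> measurable_fun setT (fun w => F x (Z w)).
Proof. by move=> mZ; exact: (measurableT_comp (F_measurable x) mZ). Qed.

Lemma objective_shift (x : 'rV[R]_n) :
  f x = (\int[P]_w (F x (xi w) + c)%:E - c%:E)%E.
Proof.
rewrite /f /objective unlock; apply: integral_shift => //.
exact: measurable_integrand.
Qed.

Lemma shifted_objective_ge0 (x : 'rV[R]_n) :
  (0 <= \int[P]_w (F x (xi w) + c)%:E)%E.
Proof.
by apply: integral_ge0 => w _; rewrite lee_fin -lerBlDr sub0r.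
Qed.

Lemma objective_ge (x : 'rV[R]_n) : ((- c)%:E <= f x)%E.
Proof.
by rewrite objective_shift EFinN leeBrDr// -EFinN addeC subee// shifted_objective_ge0.
Qed.

Lemma closed_objective_sublevel (a : R) : closed [set x | (f x <= a%:E)%E].
Proof.
move=> x clx.
have [v [vP vx]] : exists v : nat -> 'rV[R]_n,
    (forall j, (f (v j) <= a%:E)%E) /\ v j @[j --> \oo] --> x.
  have ex j : exists y, (f y <= a%:E)%E /\ ball x j.+1%:R^-1 y.
    have [|y [fy xy]] := clx (ball x j.+1%:R^-1); last by exists y.
    by apply: nbhsx_ballx; rewrite invr_gt0.
  have [v vP] := choice ex.
  exists v; split=> [j|]; first by have [] := vP j.
  apply/cvg_ballP => e e0.
  near=> j; have [_] := vP j; apply: le_ball.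
  near: j; apply: filterS (near_infty_natSinv_lt (PosNum e0)) => j /ltW; exact.
have mI y : measurable_fun setT (fun w => (F y (xi w) + c)%:E).
  by apply/measurable_EFinP/measurable_funD => //; exact: measurable_integrand.
have I0 y w : (0 <= (F y (xi w) + c)%:E)%E by rewrite lee_fin -lerBlDr sub0r.
rewrite /= objective_shift leeBlDr//.
have := fatou P measurableT (fun j => mI (v j)) (fun j w _ => I0 (v j) w).
rewrite (eq_integral (fun w => (F x (xi w) + c)%:E)); last first.
  move=> w _; have cv : (F (v j) (xi w) + c)%:E @[j --> \oo] --> (F x (xi w) + c)%:E.
    apply: cvg_EFin; first exact: nearW.
    apply: cvgD; last exact: cvg_cst.
    exact: (@cvg_comp _ _ _ v (fun y => F y (xi w)) _ _ _ vx (@F_continuous (xi w) x)).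
  rewrite is_cvg_limn_einfE; first exact/cvg_lim.
  exact: (cvgP _ cv).
move=> /le_trans; apply.
rewrite limn_einf_lim; apply: lime_le; first exact: is_cvg_einfs.
apply: nearW => j; apply: (@le_trans _ _ (\int[P]_w (F (v j) (xi w) + c)%:E)%E).
  by apply: ereal_inf_lbound; exists j => //=.
by have := vP j; rewrite objective_shift leeBlDr.
Unshelve. all: by end_near. Qed.

Lemma lln_saa (y : 'rV[R]_n) (fy eps delta : R) : f y = fy%:E ->
  0 < eps -> 0 < delta ->
  exists M, forall Z, iid_sample P xi Z ->
  exists B, [/\ measurable B, (P B <= delta%:E)%E &
    forall w, ~ B w -> forall k, (0 < k)%N -> (M <= k)%N ->
      saa F (Z ^~ w) k y <= fy + eps].
Proof.
move=> fyE eps0 delta0.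
have mX (Z : Omega -> 'rV[R]_m) : random_vector Z ->
    measurable_fun setT (fun w => F y (Z w) + c).
  by move=> mZ; apply: measurable_funD => //; exact: measurable_integrand.
have X_ge0 u : 0 <= F y u + c by rewrite -lerBlDr sub0r.
pose X0 : {mfun Omega >-> R} := mfun_Sub (mem_set (mX _ xi_random)).
have EX0 : (\int[P]_w (X0 w)%:E = (fy + c)%:E)%E.
  move: fyE; rewrite objective_shift EFinD => <-.
  by rewrite subeK.
have [M M0 MP] := @lln_upper _ _ _ P X0 (fy + c) eps delta (fun w => X_ge0 _) EX0 eps0 delta0.
exists M => Z [mZ Zlaw Zind].
pose X i : {mfun Omega >-> R} := mfun_Sub (mem_set (mX _ (mZ i))).
have mFc : measurable_fun setT ((fun u => F y u + c) : borelRn R m -> R).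
  exact: measurable_funD.
have preX (Z' : Omega -> 'rV[R]_m) A :
    (fun w => F y (Z' w) + c) @^-1` A = Z' @^-1` ((fun u => F y u + c) @^-1` A).
  by [].
have mpre A : measurable A ->
    measurable ((fun u => F y u + c) @^-1` A : set (borelRn R m)).
  by move=> mA; rewrite -[X in measurable X]setTI; exact: mFc.
have Xlaw i : same_law P (X i) X0.
  by move=> A mA; exact: (Zlaw i _ (mpre A mA)).
have Xind i j : i != j -> independent P (X i) (X j).
  move=> ij A B mA mB.
  pose D k := if k == i then (fun u => F y u + c) @^-1` A
              else (fun u => F y u + c) @^-1` B.
  have mD k : measurable (D k : set (borelRn R m)).
    by rewrite /D; case: ifP => _; exact: mpre.
  have uij : uniq [:: i; j] by rewrite /= inE ij.
  have := Zind [:: i; j] D uij mD.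
  rewrite !big_cons big_nil mule1 {2 3}/D eqxx eq_sym (negbTE ij) => <-.
  congr (P _); apply/seteqP; split => [w [Aw Bw] k|w h].
    rewrite /= !inE /D => /orP[/eqP->|/eqP->]; first by rewrite eqxx.
    by rewrite eq_sym (negbTE ij).
  split.
    by have := h i; rewrite /= !inE eqxx /D eqxx => /(_ isT).
  by have := h j; rewrite /= !inE eqxx orbT /D eq_sym (negbTE ij) => /(_ isT).
have := MP X (fun i w => X_ge0 _) Xlaw Xind.
set B := \bigcup_(k in _) _ => PB.
exists B; split => //.
  apply: bigcup_measurable => k _; rewrite -[X in measurable X]setTI.
  rewrite (_ : _ `&` _ = setT `&`
      (fun w => k%:R * (fy + c + eps) < \sum_(i < k) X i w) @^-1` [set true]).
    by apply: measurable_fun_ltr => //; exact: measurable_sum.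
  by apply/seteqP; split.
move=> w nBw k k0 Mk; apply: saa_le => //.
have : \sum_(i < k) X i w <= k%:R * (fy + c + eps).
  by rewrite leNgt; apply/negP => lt; apply: nBw; exists k.
rewrite /= big_split/= sumr_const card_ord -[c *+ k]mulr_natl.
lra.
Qed.

End objective.

(** * Convergence *)

Section convergence.
Context (R : realType) (d : measure_display)
    (Omega : measurableType d) (P : probability Omega R) (n m : nat)
    (F : 'rV[R]_n -> 'rV[R]_m -> R) (xi : Omega -> 'rV[R]_m)
    (h : nat -> R)
    (mB MB r beta gamma gammabar : R)
    (x0 : 'rV[R]_n) (N0 : nat) (theta0 : R)
    (z zt : nat -> nat -> Omega -> 'rV[R]_m) (N Nt : nat -> Omega -> nat)
    (theta alpha : nat -> Omega -> R) (p x : nat -> Omega -> 'rV[R]_n)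
    (c C0 C1 alphabar : R).
Let f := objective P F xi.
Hypotheses (xi_random : random_vector xi)
    (F_measurable : forall y, measurable_fun setT (F y : borelRn R m -> R))
    (c_ge0 : 0 <= c) (F_ge : forall y u, - c <= F y u)
    (h_ge0 : forall M, 0 <= h M)
    (h_decreasing : decreasing_seq h)
    (N0_gt0 : (0 < N0)%N)
    (beta_gt0 : 0 < beta) (gamma_gt0 : 0 < gamma) (mB_gt0 : 0 < mB)
    (run : forall w : Omega,
      IR_NS F h mB MB r beta gamma gammabar x0 N0 theta0
        (fun k i => z k i w) (fun k i => zt k i w) (N ^~ w) (Nt ^~ w)
        (theta ^~ w) (alpha ^~ w) (p ^~ w) (x ^~ w))
    (sampling : saa_sampling P F xi z zt N Nt x)
    (C0_bound : forall w, F x0 (xi w) <= C0)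
    (C1_bound : forall w, (\sum_(0 <= k <oo) (h (N k w))%:E <= C1%:E)%E)
    (A4 : assumption_A4 f)
    (alphabar_gt0 : 0 < alphabar)
    (alpha_ge : forall k w, alphabar <= alpha k w).

Lemma h_gt0 M : 0 < h M.
Proof.
apply: le_lt_trans (h_ge0 M.+1) _.
by rewrite lt_neqAle eq_le !h_decreasing leqnSn ltnn.
Qed.

Lemma h_sum_le w k : \sum_(j < k) h (N j w) <= C1.
Proof.
rewrite -lee_fin; apply: le_trans (C1_bound w).
rewrite -sumEFin -(big_mkord xpredT (fun j => (h (N j w))%:E)).
by apply: nneseries_lim_ge => j _; rewrite lee_fin.
Qed.

Lemma ae_initial_saa_le :
  {ae P, forall w, saa F (fun i => z 0%N i w) N0 x0 <= C0}.
Proof.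
have [iid _ _ _] := sampling; have [[mz zlaw _] _] := iid 0%N.
have : {ae P, forall w, forall i, F x0 (z 0%N i w) <= C0}.
  apply/ae_foralln => i.
  pose A : set (borelRn R m) := F x0 @^-1` [set` `]C0, +oo[].
  have mA : measurable A.
    by rewrite -[A]setTI; apply: F_measurable.
  exists (z 0%N i @^-1` A); split.
  - by rewrite -[X in measurable X]setTI; exact: mz.
  - apply: (eq_trans (zlaw i _ mA)).
    rewrite (_ : xi @^-1` A = set0) ?measure0//.
    apply/seteqP; split => w //; rewrite /A/= in_itv/= andbT.
    by rewrite ltNge C0_bound.
  - by move=> w /= /negP; rewrite -ltNge /A/= in_itv/= andbT.
apply: filterS => w le; apply: saa_le => //.
rewrite mulr_natl -[X in _ *+ X]card_ord -sumr_const.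
by apply: ler_sum => i _.
Qed.

Let cap := C0 + beta * C1.

Lemma ae_objective_le k : {ae P, forall w, (f (x k w) <= cap%:E)%E}.
Proof.
have [_ _ _ /(_ k)[ce _]] := sampling.
apply: (ae_le_cond_expectation ce).
apply: filterS ae_initial_saa_le => w C0w; rewrite lee_fin.
exact: (run_tilde_le beta_gt0 gamma_gt0 (run w) (h_sum_le w) C0w
  alphabar_gt0 (alpha_ge ^~ w)).
Qed.

Lemma integral_objective_iterate_le (y : 'rV[R]_n) (fy e : R) :
  f y = fy%:E -> 0 < e ->
  exists K, forall k, (K <= k)%N ->
    (\int[P]_w f (x k w) <= (fy + e)%:E)%E.
Proof.
move=> fyE e0.
pose e1 := e / 5; have e10 : 0 < e1 by rewrite divr_gt0.
have fyc : 0 <= fy + c.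
  by have := objective_ge P xi_random F_measurable c_ge0 F_ge y;
    rewrite -/f fyE lee_fin -lerBlDr sub0r.
have [V1 V10 V1P] : exists2 V, 0 < V &
    forall v, (f v <= cap%:E)%E -> sqnorm (y - v) <= V.
  have [V VP] := bounded_sqnorm y (A4 cap).
  exists (Num.max V 0 + 1); first by rewrite ltr_wpDl// le_max lexx orbT.
  by move=> v fv; rewrite (le_trans (VP v fv))// ler_wpDr// le_max lexx.
pose s := V1 / e1; have s0 : 0 < s by rewrite divr_gt0.
have sV : V1 / s = e1 by rewrite /s; field; rewrite !gt_eqF.
pose Q := (mB * alphabar) ^- 2.
have Q0 : 0 < Q by rewrite invr_gt0 exprn_gt0// mulr_gt0.
pose C3 := cap + (Q + 1) / 2 * ((cap + c) / gamma).
pose C4 := Num.max (C3 + c) 0 + 1.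
have C40 : 0 < C4 by rewrite ltr_wpDl// le_max lexx orbT.
have C34 : C3 + c <= C4 by rewrite ler_wpDr// le_max lexx.
have [M MP] := lln_saa xi_random F_measurable c_ge0 F_ge fyE e10
  (divr_gt0 e10 C40).
have hM0 := h_gt0 M.
have [iid mN mx ce] := sampling.
pose q k w := sqnorm (x k.+1 w - x k w).
have mq k : measurable_fun setT (q k) by exact: measurable_sqnorm_sub.
have q0 k w : 0 <= q k w by exact: sqnorm_ge0.
have mh k : measurable_fun setT (fun w => h (N k w)).
  by have [+ _] := mN k; apply: measurableT_comp.
pose a := s * Q / 2; have a0 : 0 < a by rewrite divr_gt0// mulr_gt0.
pose b := C4 / h M; have b0 : 0 < b by rewrite divr_gt0.
have qsum : {ae P, forall w, forall k,
    \sum_(j < k) q j w <= (cap - - c) / gamma}.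
  apply: filterS ae_initial_saa_le => w C0w k.
  exact: (run_step_summable F_ge N0_gt0 beta_gt0 gamma_gt0 (run w)
    (h_sum_le w) C0w).
have [K1 K1P] := summable_integral_le (divr_gt0 e10 a0) mq q0 qsum.
have [K2 K2P] := summable_integral_le (divr_gt0 e10 b0) mh
  (fun k w => h_ge0 _) (aeW P h_sum_le).
exists (maxn K1 K2) => k; rewrite geq_max => /andP[K1k K2k].
have [B [mB' PB BP]] := MP _ (iid k.+1).1.
pose U w := saa F (fun i => z k.+1 i w) (N k.+1 w) (x k w).
have ceU := (ce k).2.
have mU : measurable_fun setT U.
  by case: ceU => + _ _ _; move=> /measurable_int /measurable_EFinP.
have Ngt0 w : (0 < N k.+1 w)%N by exact: (run_N_gt0 N0_gt0 (run w)).
have Uge w : - c <= U w by exact: saa_ge.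
have -> : (\int[P]_w f (x k w) = \int[P]_w (U w + c)%:E - c%:E)%E.
  rewrite -integral_shift//.
  case: ceU => _ _ mZ; apply; rewrite -(preimage_setT (fun w => f (x k w))).
  exact: mZ.
have cst0 : 0 <= fy + c + 2 * e1 by rewrite (addr_ge0 fyc)// mulr_ge0// ltW.
(* The last two terms dominate [U + c] on the bad events [N k.+1 < M] and
   [B], respectively, where [run_near_optimality] is of no use. *)
pose rhs w := (((fy + c + 2 * e1) + a * q k w) + b * h (N k.+1 w)) + C4 * \1_B w.
have UR : {ae P, forall w, U w + c <= rhs w}.
  apply: filterS2 ae_initial_saa_le (ae_objective_le k) => w C0w fxk.
  have Ule := run_next_saa_le F_ge N0_gt0 beta_gt0 gamma_gt0 mB_gt0 (run w)
    (h_sum_le w) C0w alphabar_gt0 (alpha_ge ^~ w) k.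
  have aq0 : 0 <= a * q k w by rewrite mulr_ge0// ltW.
  have bh0 : 0 <= b * h (N k.+1 w) by rewrite mulr_ge0// ltW.
  have Ule4 : U w + c <= C4.
    by apply: le_trans C34; rewrite lerD2r (le_trans Ule)// opprK.
  rewrite /rhs; have [Bw|nBw] := pselect (B w).
    rewrite indicE mem_set// mulr1 (le_trans Ule4)// lerDr.
    exact: (addr_ge0 (addr_ge0 cst0 aq0) bh0).
  rewrite indicE memNset// mulr0 addr0.
  have [NM|MN] := ltnP (N k.+1 w) M.
    rewrite (le_trans Ule4)//.
    apply: (@le_trans _ _ (b * h (N k.+1 w))); last first.
      by rewrite lerDr (addr_ge0 cst0 aq0).
    rewrite /b mulrAC ler_pdivlMr// ler_pM2l//.
    by rewrite h_decreasing ltnW.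
  have lln := BP w nBw _ (Ngt0 w) MN.
  have mino := run_near_optimality mB_gt0 (run w) alphabar_gt0 (alpha_ge ^~ w) k y s0.
  have Vs : sqnorm (y - x k w) / s <= e1.
    by rewrite -sV ler_pM2r ?invr_gt0// V1P.
  have aqE : s * (q k w / (mB * alphabar) ^+ 2) / 2 = a * q k w.
    by rewrite /a /Q; ring.
  move: mino lln aqE; rewrite -/(U w) -/(q k w) => mino lln aqE.
  have : U w <= fy + e1 + (a * q k w + e1 / 2).
    rewrite -aqE; lra.
  lra.
have mU1 : measurable_fun setT (fun w => (U w + c)%:E).
  by apply/measurable_EFinP/measurable_funD.
have mcst : measurable_fun [set: Omega] (fun=> fy + c + 2 * e1) by exact: measurable_cst.
have maq : measurable_fun setT (fun w => a * q k w) by exact: measurable_funM.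
have mbh : measurable_fun setT (fun w => b * h (N k.+1 w)) by exact: measurable_funM.
have mC4 : measurable_fun setT (fun w => C4 * \1_B w).
  by apply: measurable_funM => //; exact: measurable_indic.
have aq0 w : 0 <= a * q k w by rewrite mulr_ge0// ltW.
have bh0 w : 0 <= b * h (N k.+1 w) by rewrite mulr_ge0// ltW.
have C4B0 w : 0 <= C4 * \1_B w by rewrite mulr_ge0// ltW.
have le1 : (\int[P]_w (U w + c)%:E <= \int[P]_w (rhs w)%:E)%E.
  apply: ae_ge0_le_integral => //.
  - by move=> w _; rewrite lee_fin -lerBlDr sub0r.
  - move=> w _; rewrite lee_fin.
    exact: (addr_ge0 (addr_ge0 (addr_ge0 cst0 (aq0 w)) (bh0 w)) (C4B0 w)).
  - by apply/measurable_EFinP; do 3![apply: measurable_funD => //].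
  - by apply: filterS UR => w le _; rewrite lee_fin.
have le2 : (\int[P]_w (rhs w)%:E <= (fy + c + 2 * e1 + e1 + e1 + e1)%:E)%E.
  rewrite /rhs; under eq_integral do rewrite EFinD.
  rewrite ge0_integralD//; last 4 first.
  - move=> w _; rewrite lee_fin.
    exact: (addr_ge0 (addr_ge0 cst0 (aq0 w)) (bh0 w)).
  - by apply/measurable_EFinP; do 2![apply: measurable_funD => //].
  - by move=> w _; rewrite lee_fin.
  - exact/measurable_EFinP.
  rewrite [leRHS]EFinD; apply: leeD; last first.
    under eq_integral do rewrite EFinM.
    rewrite ge0_integralZl_EFin//; last 2 first.
    - by apply/measurable_EFinP; exact: measurable_indic.
    - exact: ltW.
    rewrite integral_indic// setIT.
    apply: (le_trans (lee_wpmul2l _ PB)); first by rewrite lee_fin ltW.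
    by rewrite -EFinM lee_fin mulrCA divff ?mulr1// gt_eqF.
  under eq_integral do rewrite EFinD.
  rewrite ge0_integralD//; last 4 first.
  - by move=> w _; rewrite lee_fin (addr_ge0 cst0 (aq0 w)).
  - by apply/measurable_EFinP; apply: measurable_funD.
  - by move=> w _; rewrite lee_fin.
  - exact/measurable_EFinP.
  rewrite [leRHS]EFinD; apply: leeD; last first.
    under eq_integral do rewrite EFinM.
    rewrite ge0_integralZl_EFin//; last 3 first.
    - by move=> w _; rewrite lee_fin.
    - exact/measurable_EFinP.
    - exact: ltW.
    apply: (le_trans (lee_wpmul2l _ (K2P k.+1 (leqW K2k)))).
      by rewrite lee_fin ltW.
    by rewrite -EFinM lee_fin mulrCA divff ?mulr1// gt_eqF.
  under eq_integral do rewrite EFinD.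
  rewrite ge0_integralD//; last 2 first.
  - by move=> w _; rewrite lee_fin.
  - exact/measurable_EFinP.
  rewrite [leRHS]EFinD; apply: leeD.
    by rewrite integral_cst//= probability_setT mule1.
  under eq_integral do rewrite EFinM.
  rewrite ge0_integralZl_EFin//; last 3 first.
  - by move=> w _; rewrite lee_fin.
  - exact/measurable_EFinP.
  - exact: ltW.
  apply: (le_trans (lee_wpmul2l _ (K1P k K1k))); first by rewrite lee_fin ltW.
  by rewrite -EFinM lee_fin mulrCA divff ?mulr1// gt_eqF.
rewrite leeBlDr// (le_trans le1)// (le_trans le2)// -EFinD lee_fin.
by rewrite /e1; lra.
Qed.

End convergence.

Section minimizing.
Local Open Scope ereal_scope.

Lemma ae_frequently_lt d (T : measurableType d) (R : realType)
    (P : probability T R) (g : nat -> T -> \bar R) :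
  (forall k, measurable_fun setT (g k)) -> (forall k w, 0 <= g k w) ->
  (forall e : R, (0 < e)%R -> exists K, forall k, (K <= k)%N ->
    \int[P]_w g k w <= e%:E) ->
  {ae P, forall w, forall (e : R) K, (0 < e)%R ->
    exists2 k, (K <= k)%N & g k w < e%:E}.
Proof.
move=> mg g0 gP.
pose G K w := einfs (g ^~ w) K.
have mG K : measurable_fun setT (G K) by exact: measurable_fun_einfs.
have G0 K w : 0 <= G K w.
  by apply: le_ereal_inf_tmp => _ [k _ <-]; exact: g0.
have IG K : \int[P]_w `|G K w| = 0.
  under eq_integral do rewrite gee0_abs//.
  apply/eqP; rewrite eq_le integral_ge0// andbT.
  apply/lee_addgt0Pr => e e0; rewrite add0e.
  have [K' K'P] := gP e e0.
  apply: le_trans (K'P (maxn K K') (leq_maxr _ _)).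
  apply: ge0_le_integral => // w _; apply: ereal_inf_lbound.
  by exists (maxn K K') => //=; exact: leq_maxl.
have : {ae P, forall w, forall K, G K w = 0}.
  apply/ae_foralln => K.
  have := IG K; move=> /(ae_eq_integral_abs P measurableT (mG K)).
  by apply: filterS => w; apply.
apply: filterS => w Gw e K e0.
have : G K w < e%:E by rewrite Gw lte_fin.
by move=> /ereal_inf_lt[_ [k Kk <-]] ?; exists k.
Qed.

Lemma cluster_minimizer (R : realType) (n : nat) (f : 'rV[R]_n -> \bar R)
    (fs : R) (X : nat -> 'rV[R]_n) :
  assumption_A4 f -> (forall a : R, closed [set v | f v <= a%:E]) ->
  (forall (e : R) K, (0 < e)%R ->
    exists2 k, (K <= k)%N & f (X k) <= (fs + e)%:E) ->
  exists2 v, cluster (X k @[k --> \oo]) v & f v <= fs%:E.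
Proof.
move=> A4 cl freq.
pose D := [set i : nat * R | (0 < i.2)%R].
pose B (i : nat * R) := X @` [set k | (i.1 <= k)%N /\ f (X k) <= (fs + i.2)%:E].
have FG : ProperFilter (filter_from D B).
  apply: filter_from_proper.
    apply: filter_from_filter; first by exists (0%N, 1%R); rewrite /D/=.
    move=> [K1 e1] [K2 e2] /= e10 e20.
    exists (maxn K1 K2, Num.min e1 e2); first by rewrite /D/= lt_min e10.
    move=> _ [k /= [Kk fk] <-]; move: Kk; rewrite geq_max => /andP[K1k K2k].
    split; exists k => //=; split => //; apply: (le_trans fk).
      by rewrite lee_fin lerD2l ge_min lexx.
    by rewrite lee_fin lerD2l ge_min lexx orbT.
  move=> [K e] /= e0; have [k Kk fk] := freq e K e0.
  by exists (X k); exists k.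
have GL (e : R) : (0 < e)%R -> filter_from D B [set v | f v <= (fs + e)%:E].
  by move=> e0; exists (0%N, e) => // _ [k /= [_ fk] <-].
have cpt : compact [set v | f v <= (fs + 1)%:E].
  by apply: bounded_closed_compact; [exact: A4|exact: cl].
have [v [_ clv]] := cpt _ FG (GL 1%R ltr01).
exists v.
  apply: cvg_cluster clv => S [K _ KS]; exists (K, 1%R); first by rewrite /D/=.
  by move=> _ [k /= [Kk _] <-]; exact: KS.
apply/lee_addgt0Pr => e e0; rewrite -EFinD.
apply: (cl (fs + e)%R) => S vS.
by have := clv _ _ (GL e e0) vS.
Qed.

End minimizing.

Theorem theorem3p1 (R : realType) (d : measure_display)
    (Omega : measurableType d) (P : probability Omega R) (n m : nat)
    (F : 'rV[R]_n -> 'rV[R]_m -> R) (xi : Omega -> 'rV[R]_m)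
    (h : nat -> R)
    (mB MB r beta gamma gammabar : R)
    (x0 : 'rV[R]_n) (N0 : nat) (theta0 : R)
    (z zt : nat -> nat -> Omega -> 'rV[R]_m) (N Nt : nat -> Omega -> nat)
    (theta alpha : nat -> Omega -> R) (p x : nat -> Omega -> 'rV[R]_n)
    (C0 C1 alphabar : R)
    (f := objective P F xi)
    (D := [set y : 'rV[R]_n | (f y <= (C0 + 2 * beta * C1)%:E)%E])
    (xi_random : random_vector xi)
    (F_regular : regular_integrand F)
    (h_ge0 : forall M, 0 <= h M)
    (h_decreasing : decreasing_seq h)
    (h_cvg0 : h M @[M --> \oo] --> (0 : R))
    (r01 : 0 < r < 1) (theta01 : 0 < theta0 < 1) (N0_gt0 : (0 < N0)%N)
    (beta_gt0 : 0 < beta) (gamma_gt0 : 0 < gamma) (gammabar_gt0 : 0 < gammabar)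
    (mB_gt0 : 0 < mB) (mB_le_MB : mB <= MB)
    (A2 : assumption_A2 F mB MB)
    (run : forall w : Omega,
      IR_NS F h mB MB r beta gamma gammabar x0 N0 theta0
        (fun k i => z k i w) (fun k i => zt k i w) (N ^~ w) (Nt ^~ w)
        (theta ^~ w) (alpha ^~ w) (p ^~ w) (x ^~ w))
    (sampling : saa_sampling P F xi z zt N Nt x)
    (C0_bound : forall w, F x0 (xi w) <= C0)
    (C1_gt0 : 0 < C1)
    (C1_bound : forall w, (\sum_(0 <= k <oo) (h (N k w))%:E <= C1%:E)%E)
    (A4 : assumption_A4 f)
    (A5 : assumption_A5 P F xi D)
    (alphabar_gt0 : 0 < alphabar)
    (alpha_ge : forall k w, alphabar <= alpha k w) :
  {ae P, forall w, exists xstar : 'rV[R]_n,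
    cluster (x k w @[k --> \oo]) xstar /\ f xstar = ereal_inf (range f)}.
Proof.
have [F_measurable F_continuous _ [Cl F_geCl]] := F_regular.
pose c := Num.max (- Cl) 0.
have c_ge0 : 0 <= c by rewrite le_max lexx orbT.
have F_ge y u : - c <= F y u.
  by apply: le_trans (F_geCl y u); rewrite lerNl le_max lexx.
have fge := objective_ge P xi_random F_measurable c_ge0 F_ge.
have fx0 : (f x0 <= C0%:E)%E.
  rewrite /f (objective_shift P xi_random F_measurable c_ge0 F_ge) leeBlDr//.
  apply: (@le_trans _ _ (\int[P]_w (cst (C0%:E + c%:E)%E w))%E).
    apply: ge0_le_integral => //.
    - by move=> w _; rewrite lee_fin -lerBlDr sub0r.
    - apply/measurable_EFinP/measurable_funD => //.
      exact: measurable_integrand.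
    - by move=> w _; rewrite -EFinD lee_fin lerD2r.
  by rewrite integral_cst//= probability_setT mule1.
have inf_ge : ((- c)%:E <= ereal_inf (range f))%E.
  by apply: le_ereal_inf_tmp => _ [y _ <-]; exact: fge.
have inf_le y : (ereal_inf (range f) <= f y)%E.
  by apply: ereal_inf_lbound; exists y.
have [fs fsE] : exists fs : R, ereal_inf (range f) = fs%:E.
  exists (fine (ereal_inf (range f))); rewrite fineK// fin_numE.
  rewrite -ltNye -ltey (lt_le_trans _ inf_ge) ?ltNyr//=.
  by rewrite (le_lt_trans (inf_le x0))// (le_lt_trans fx0)// ltry.
have fs_le y : (fs%:E <= f y)%E by rewrite -fsE.
have [_ _ _ ce] := sampling.
have ifx k : P.-integrable setT (fun w => f (x k w)).
  by have [[_ + _ _] _] := ce k.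
have icst : P.-integrable setT (cst fs%:E).
  exact: finite_measure_integrable_cst.
pose g k w := (f (x k w) - fs%:E)%E.
have mg k : measurable_fun setT (g k).
  exact: (measurable_int P (integrableB measurableT (ifx k) icst)).
have g0 k w : (0 <= g k w)%E by rewrite /g sube_ge0.
have Ig (e : R) : 0 < e -> exists K, forall k, (K <= k)%N ->
    (\int[P]_w g k w <= e%:E)%E.
  move=> e0.
  have e20 : 0 < e / 2 by rewrite divr_gt0.
  have [_ [y _ <-]] := lb_ereal_inf_adherent e20
    (eq_ind_r (fun t => t \is a fin_num) (isT : fs%:E \is a fin_num) fsE).
  rewrite fsE => fy_lt.
  have [fy fyE] : exists fy : R, f y = fy%:E.
    exists (fine (f y)); rewrite fineK// fin_numE -ltNye -ltey.
    rewrite (lt_le_trans _ (fs_le y)) ?ltNyr//=.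
    by rewrite (lt_trans fy_lt)// -EFinD ltry.
  have [K KP] := integral_objective_iterate_le xi_random F_measurable c_ge0
    F_ge h_ge0 h_decreasing N0_gt0 beta_gt0 gamma_gt0 mB_gt0 run sampling
    C0_bound C1_bound A4 alphabar_gt0 alpha_ge fyE e20.
  exists K => k Kk.
  have -> : (\int[P]_w g k w = \int[P]_w f (x k w) - \int[P]_w (cst fs%:E w))%E.
    exact: (integralB measurableT (ifx k) icst).
  rewrite integral_cst//= probability_setT mule1 leeBlDr//.
  rewrite (le_trans (KP k Kk))// -EFinD lee_fin.
  by move: fy_lt; rewrite fyE -EFinD lte_fin; lra.
apply: filterS (ae_frequently_lt mg g0 Ig) => w freq.
have cl a : closed [set v | (f v <= a%:E)%E].
  exact: (closed_objective_sublevel xi_random F_measurable F_continuous c_ge0 F_ge).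
have [|v clv fv] := @cluster_minimizer _ _ f fs (x ^~ w) A4 cl.
  move=> e K e0; have [k Kk gk] := freq e K e0; exists k => //.
  by rewrite addrC EFinD -leeBlDr// ltW.
by exists v; split => //; rewrite fsE; apply/eqP; rewrite eq_le fv fs_le.
Qed.
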